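(* Fix $q\in[2,\infty]$. Let $Y_1,Y_2,\ldots$ be i.i.d. real random variables with density proportional to $e^{-|x|^q}$, and let $\gamma_p=\sqrt{2}\Big(\frac{\Gamma(\frac{p+1}{2})}{\sqrt{\pi}}\Big)^{1/p}$. Then for every $n\ge1$, all real numbers $a_1,\ldots,a_n$ and every $p\ge2$, $$\Big\|\sum_{i=1}^n a_iY_i\Big\|_p\le\gamma_p\Big\|\sum_{i=1}^n a_iY_i\Big\|_2,$$ whereas for every $p\in[1,2]$ the reverse inequality $$\Big\|\sum_{i=1}^n a_iY_i\Big\|_p\ge\gamma_p\Big\|\sum_{i=1}^n a_iY_i\Big\|_2$$ holds. The constant $\gamma_p$ is optimal: it cannot be replaced by a smaller constant (for $p\ge 2$), respectively a larger constant (for $p\in[1,2]$), for which the inequality holds for all $n\geq 1$ and all real $a_1,\ldots,a_n$.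
   Context: For a real random variable $S$ and $r>0$, $\|S\|_r=(\mathbb{E}|S|^r)^{1/r}$. The number $\gamma_p$ is $\|G\|_p$ for a standard Gaussian random variable $G$. For $q=\infty$, ''density proportional to $e^{-|x|^q}$'' means the uniform distribution on $[-1,1]$. *)

(* Defs.v *)
From HB Require Import structures.
From mathcomp Require Import all_boot all_order all_algebra finmap.
From mathcomp Require Import all_classical all_reals all_analysis.

Set Implicit Arguments.
Unset Strict Implicit.
Unset Printing Implicit Defensive.

Import Order.TTheory GRing.Theory Num.Theory.
Import numFieldNormedType.Exports.

Local Open Scope classical_set_scope.
Local Open Scope ring_scope.

(* Meaningful for s > 0, where Euler's integral converges. *)
Definition Gamma (R : realType) (s : R) : R :=
  (\int[lebesgue_measure]_(t in `]0%R, +oo[) (t `^ (s - 1) * expR (- t)))%R.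

Definition gauss_const (R : realType) (p : R) : R :=
  Num.sqrt 2 * (Gamma ((p + 1) / 2) / Num.sqrt pi) `^ p^-1.

Definition mutually_independent (d : measure_display) (T : measurableType d)
    (R : realType) (P : probability T R) (I : choiceType)
    (X : I -> {RV P >-> R}) : Prop :=
  forall (J : {fset I}) (A : I -> set R),
    (forall i, i \in J -> measurable (A i)) ->
    P (\bigcap_(i in [set` J]) (X i @^-1` A i)) =
    (\prod_(i <- J) P (X i @^-1` A i))%E.

(* The law of X has a density with respect to Lebesgue measure which is a
   constant multiple of f; the constant is forced to be 1 / (integral of f). *)
Definition density_proportional_to (d : measure_display) (T : measurableType d)
    (R : realType) (P : probability T R) (X : {RV P >-> R}) (f : R -> R) : Prop :=
  exists2 c : R, 0 < c &
    forall A : set R, measurable A ->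
      distribution P X A = (\int[lebesgue_measure]_(x in A) (c * f x)%:E)%E.

Arguments mutually_independent {d T R} P {I} X.
Arguments density_proportional_to {d T R} P X f.

(* The law with density proportional to exp (- |x| ^ q), read as the uniform law
   on [-1, 1] for q = +oo; the value -oo of q is junk. *)
Definition has_exp_power_law (d : measure_display) (T : measurableType d)
    (R : realType) (P : probability T R) (q : \bar R) (X : {RV P >-> R}) : Prop :=
  match q with
  | r%:E => density_proportional_to P X (fun x => expR (- (`|x| `^ r)))
  | +oo%E => forall A : set R, measurable A ->
      distribution P X A = uniform_prob (gtrN (@ltr01 R)) A
  | -oo%E => False
  end.

Arguments has_exp_power_law {d T R} P q X.

Definition lincomb (T : Type) (R : realType) (n : nat) (a : 'I_n -> R)
    (Y : nat -> T -> R) : T -> R :=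
  fun w => \sum_(i < n) a i * Y i w.

(* Main.v *)
Require Import Defs.
From HB Require Import structures.
From mathcomp Require Import all_boot all_order all_algebra finmap.
From mathcomp Require Import all_classical all_reals all_analysis.
From mathcomp Require Import measurable_realfun ring lra.

Set Implicit Arguments.
Unset Strict Implicit.
Unset Printing Implicit Defensive.

Import Order.TTheory GRing.Theory Num.Theory.
Import numFieldNormedType.Exports.

Local Open Scope classical_set_scope.
Local Open Scope ring_scope.

(** The law of the [Y i] enters through a single comparison. Say that an even
    function [phi] has rising curvature when each second difference
    [phi (x + s) + phi (x - s) - 2 * phi x] increases with [`|x|]. Such are
    [x ^+ 2] and [- x ^+ 2], the function [`|x| `^ p] when [2 <= p], and its
    opposite when [1 <= p <= 2]. Functions of rising curvature are convex in
    [x ^+ 2] ([rising_curvature_convex_sqr]). Let [f] be the density of [Y i]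
    and [g] the centred Gaussian density with the same variance [s ^+ 2]. Since
    [2 <= q], the points where [g < f] form, as [`|x|] varies, an interval.
    Subtract from [phi] the affine function of [x ^+ 2] that agrees with it at
    the ends of this interval: the difference has the sign of [g - f], while
    the subtracted function has the same integral against [f] and [g]. Hence
    the mean of [phi] under [f] is at most its mean under [g] ([crossing_le]).

    For sums, replace the summands one at a time by Gaussian ones of the same
    variance. Averaging a function of rising curvature over the other summands,
    whose densities are even and unimodal, gives again a function of rising
    curvature ([rising_curvature_avg]), so the one-variable comparison applies
    to every summand ([replacement]). Applied to [`|x| `^ p] or to its opposite,
    this bounds the moments of the sum by those of a Gaussian variable of the
    same variance, from above or from below; the Gaussian moments are given by
    Euler's integral ([gauss_abs_moment]).

    Optimality comes from equal weights and the central limit theorem. The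
    same replacement scheme, with a quantitative smoothness class
    ([third_order]) in place of rising curvature and an error [C * `|a i| ^+ 3]
    for each summand, shows that the mean of a smooth bounded function of the
    normalized sum tends to its Gaussian mean ([third_order_clt]). The moment of
    order [p] of any law is a fixed multiple of the integral of
    [`|t| `^ (p - 1)] times the mean of [step (x / t)], for a smooth step
    function vanishing near 0 ([layer_cake]). Fatou's lemma then bounds the
    Gaussian moment by a limit of moments of sums; that settles [2 <= p]. For
    [p <= 2] it is applied to the excess of the second moment, which does not
    depend on the number of summands, over the moment of order [p]. *)

(** * Integration on the line *)

Section Integrals.
Context {R : realType}.
Local Notation leb := (@lebesgue_measure R).

Lemma ge0_integral_affine (a b : R) (h : R -> \bar R) : a != 0 ->
  measurable_fun setT h -> (forall x, 0 <= h x)%E ->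
  (\int[leb]_x h x = `|a|%:E * \int[leb]_x h (a * x + b)%R)%E.
Proof.
move=> a0 mh h0.
pose phi (x : measurableTypeR R) : measurableTypeR R := a * x + b.
have mphi : measurable_fun setT phi.
  by apply: measurable_funD => //; exact: measurable_funM.
(* The rescaled image of Lebesgue measure agrees with it on half-open intervals. *)
rewrite -(@ge0_integral_pushforward _ _ _ _ _ phi mphi leb setT h)//.
have na : 0 <= `|a| by [].
rewrite -(@ge0_integral_mscale _ _ _ _ _ measurableT (NngNum na))//.
apply: eq_measure_integral => A mA _; apply: lebesgue_measure_unique => //.
move=> _ [[c e]] _ <-; rewrite /= /mscale/= /pushforward/=.
have [ap|an] : 0 < a \/ a < 0 by move: a0; rewrite neq_lt => /orP[]; tauto.
- have -> : phi @^-1` `]c, e]%classic = `](c - b) / a, (e - b) / a]%classic.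
    apply/seteqP; split => x /=; rewrite !in_itv/= /phi ltr_pdivrMr// ler_pdivlMr//.
      by move=> /andP[? ?]; apply/andP; split; lra.
    by move=> /andP[? ?]; apply/andP; split; lra.
  rewrite !lebesgue_measure_itv/= !lte_fin ltr_pM2r ?invr_gt0// ltrD2r.
  case: ifPn => [ce|_]; last by rewrite mule0.
  by rewrite -!EFinB -EFinM; congr EFin; rewrite gtr0_norm//; field.
- have -> : phi @^-1` `]c, e]%classic = `[(e - b) / a, (c - b) / a[%classic.
    apply/seteqP; split => x /=; rewrite !in_itv/= /phi ltr_ndivlMr// ler_ndivrMr//.
      by move=> /andP[? ?]; apply/andP; split; lra.
    by move=> /andP[? ?]; apply/andP; split; lra.
  rewrite !lebesgue_measure_itv/= !lte_fin ltr_nM2r ?invr_lt0// ltrD2r.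
  case: ifPn => [ce|_]; last by rewrite mule0.
  by rewrite -!EFinB -EFinM; congr EFin; rewrite ltr0_norm//; field.
Qed.

Lemma integrable_affine (a b : R) (h : R -> R) : a != 0 ->
  leb.-integrable setT (EFin \o h) ->
  leb.-integrable setT (EFin \o (fun x => h (a * x + b))).
Proof.
move=> a0 /integrableP[mh ih]; have mh' : measurable_fun setT h by exact/measurable_EFinP.
apply/integrableP; split.
  apply/measurable_EFinP; apply: (measurableT_comp mh').
  by apply: measurable_funD => //; exact: measurable_funM.
rewrite (@ge0_integral_affine a b) in ih => //; last exact: measurableT_comp.
rewrite -(@lte_pmul2l _ `|a|%:E) //; last by rewrite lte_fin normr_gt0.
by rewrite [ltRHS]gt0_muley// lte_fin normr_gt0.
Qed.

Lemma integral_affine (a b : R) (h : R -> R) : a != 0 ->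
  leb.-integrable setT (EFin \o h) ->
  \int[leb]_x h x = `|a| * \int[leb]_x h (a * x + b).
Proof.
move=> a0 ih; have mh : measurable_fun setT (EFin \o h) by case/integrableP : ih.
have ih' := integrable_affine b a0 ih.
rewrite /Rintegral -[X in X * _]/(fine `|a|%:E) -fineM//; last exact: integrable_fin_num ih'.
congr fine; rewrite [LHS]integralE [X in (_ * X)%E]integralE.
rewrite (@ge0_integral_affine a b _ a0 (measurable_funepos mh))//.
rewrite (@ge0_integral_affine a b _ a0 (measurable_funeneg mh))//.
rewrite [in RHS]muleBr//; last first.
  exact: fin_num_adde_defr (integrable_pos_fin_num measurableT ih').
by congr (_ * _ - _ * _)%E; apply: eq_integral => x _; rewrite ?funeposE ?funenegE.
Qed.

(** A law given by a density integrates functions against that density: both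
    sides define measures that agree on sets, hence on simple functions. *)
Lemma ge0_integral_density (mu : probability R R) (f : R -> R) (h : R -> \bar R) :
  measurable_fun setT f -> (forall x, 0 <= f x) ->
  (forall A, measurable A -> mu A = \int[leb]_(x in A) (f x)%:E)%E ->
  measurable_fun setT h -> (forall x, 0 <= h x)%E ->
  (\int[mu]_x h x = \int[leb]_x (h x * (f x)%:E))%E.
Proof.
move=> mf f0 muf mh h0.
have mEf : measurable_fun setT (EFin \o f) by exact/measurable_EFinP.
pose idR : R -> measurableTypeR R := idfun.
have midR : measurable_fun setT idR by exact: measurable_id.
pose X : {mfun R >-> measurableTypeR R} :=
  HB.pack idR (isMeasurableFun.Build _ _ _ _ idR midR).
pose nu : probability (measurableTypeR R) R := distribution mu X.
have -> : (\int[mu]_x h x = \int[nu]_x h x)%E.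
  by rewrite (@ge0_integral_distribution _ _ _ _ _ mu X).
have nuE A : measurable A -> (nu A = \int[leb]_(x in A) (f x)%:E)%E.
  exact: muf.
have idom : nu `<< leb.
  apply/null_content_dominatesP => A mA A0; rewrite nuE//.
  by apply: null_set_integral => //; exact: measurable_funTS.
have RN0 := Radon_Nikodym_SigmaFinite.f_ge0 idom.
rewrite -(Radon_Nikodym_SigmaFinite.change_of_variables idom h0 measurableT mh).
have RNi := Radon_Nikodym_SigmaFinite.f_integrable idom.
have mRN := measurable_int _ RNi.
apply: ge0_ae_eq_integral => //.
- by apply: emeasurable_funM.
- by apply: emeasurable_funM.
- by move=> x _; exact: mule_ge0.
- by move=> x _; rewrite mule_ge0// lee_fin.
apply: ae_eqe_mul2l; apply: integral_ae_eq => // A _ mA.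
by rewrite -Radon_Nikodym_SigmaFinite.f_integral//; exact: nuE.
Qed.

End Integrals.

(** * Test functions of polynomial growth and their averages *)
Section Temperate.
Context {R : realType}.
Implicit Types (phi psi : R -> R) (mu nu : probability R R).

(** Powers of [1 + x ^+ 2] are submultiplicative up to constants ([weightD],
    [weightM]), so bounds by them survive averaging. *)
Definition weight (m : nat) (x : R) : R := (1 + x ^+ 2) ^+ m.

Let one_le x : 1 <= 1 + x ^+ 2 :> R. Proof. by rewrite lerDl sqr_ge0. Qed.
Let zero_le x : 0 <= 1 + x ^+ 2 :> R. Proof. exact: le_trans (one_le x). Qed.

Lemma weight_ge1 m x : 1 <= weight m x.
Proof. exact: exprn_ege1. Qed.

Lemma weight_ge0 m x : 0 <= weight m x.
Proof. exact: le_trans (weight_ge1 m x). Qed.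

Lemma le_weight m n x : (m <= n)%N -> weight m x <= weight n x.
Proof. by move=> mn; rewrite /weight ler_weXn2l. Qed.

Lemma weight_add m n x : weight (m + n) x = weight m x * weight n x.
Proof. by rewrite /weight exprD. Qed.

Lemma weightD m x y : weight m (x + y) <= 2 ^+ m * (weight m x * weight m y).
Proof.
by rewrite /weight -!exprMn lerXn2r ?nnegrE ?mulr_ge0//; nra.
Qed.

Lemma weightM m a x : weight m (a * x) <= weight m a * weight m x.
Proof. by rewrite /weight -!exprMn lerXn2r ?nnegrE ?mulr_ge0//; nra. Qed.

Lemma norm_le_weight x : `|x| <= weight 1 x.
Proof. by rewrite /weight expr1 -(real_normK (num_real x)); nra. Qed.

Lemma continuous_weight m : continuous (weight m).
Proof.
move=> x; apply: (cvg_comp (fun x => 1 + x ^+ 2) (fun y : R => y ^+ m)).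
  by apply: cvgD; [exact: cvg_cst|exact: exprn_continuous].
exact: exprn_continuous.
Qed.

Lemma measurable_weight m : measurable_fun [set: R] (weight m).
Proof. by apply: continuous_measurable_fun; exact: continuous_weight. Qed.

(** Growth and continuity in one condition, which [temperate_avg] preserves. *)
Definition temperate phi := exists (C : R) (m : nat), 0 <= C /\
  forall x y, `|phi x - phi y| <= C * `|x - y| * (weight m x * weight m y).

Lemma temperate_bound phi : temperate phi ->
  exists (C : R) (m : nat), 0 <= C /\ forall x, `|phi x| <= C * weight m x.
Proof.
move=> [C [m [C0 phiC]]]; exists (`|phi 0| + C), m.+1; split; first by rewrite addr_ge0.
move=> x; rewrite -(subrK (phi 0) (phi x)) (le_trans (ler_normD _ _))//.
rewrite addrC mulrDl lerD//; first by rewrite ler_peMr// weight_ge1.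
rewrite (le_trans (phiC x 0))// subr0 -addn1 weight_add.
rewrite [weight m 0]/weight expr0n addr0 expr1n mulr1 -mulrA ler_wpM2l// mulrC.
by rewrite ler_wpM2l ?weight_ge0// norm_le_weight.
Qed.

Lemma temperate_continuous phi : temperate phi -> continuous phi.
Proof.
move=> [C [m [C0 phiC]]] x.
apply/cvgrPdist_lt => e e0 /=.
pose g y := C * `|x - y| * (weight m x * weight m y).
have cg : g y @[y --> x] --> 0.
  have -> : 0 = g x by rewrite /g subrr normr0 mulr0 mul0r.
  apply: cvgM; apply: cvgM; [exact: cvg_cst| |exact: cvg_cst|exact: continuous_weight].
  by apply: cvg_norm; apply: cvgB; [exact: cvg_cst|exact: cvg_id].
move/cvgr0Pnorm_lt : cg => /(_ _ e0) cg.
near=> y; rewrite (le_lt_trans (phiC x y))//.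
by rewrite (le_lt_trans (ler_norm _))//; near: y.
Unshelve. all: by end_near. Qed.

Lemma temperate_measurable phi : temperate phi -> measurable_fun [set: R] phi.
Proof. by move=> /temperate_continuous; exact: continuous_measurable_fun. Qed.

Lemma temperate_cst (c : R) : temperate (fun=> c).
Proof.
by exists 0, 0%N; split=> // x y; rewrite subrr normr0 !mul0r.
Qed.

Lemma temperateZ (k : R) phi : temperate phi -> temperate (fun x => k * phi x).
Proof.
move=> [C [m [C0 phiC]]]; exists (`|k| * C), m; split; first exact: mulr_ge0.
by move=> x y; rewrite -mulrBr normrM -!mulrA ler_wpM2l// mulrA.
Qed.

Lemma temperateN phi : temperate phi -> temperate (fun x => - phi x).
Proof.
move=> /(temperateZ (-1)); by under eq_fun do rewrite mulN1r.
Qed.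

Lemma temperateD phi psi : temperate phi -> temperate psi ->
  temperate (fun x => phi x + psi x).
Proof.
move=> [C [m [C0 phiC]]] [D [n [D0 psiD]]].
exists (C + D), (m + n)%N; split=> [|x y]; first exact: addr_ge0.
rewrite opprD addrACA (le_trans (ler_normD _ _))// 2!mulrDl lerD//.
  rewrite (le_trans (phiC x y))// ler_wpM2l// ?mulr_ge0//.
  by rewrite ler_pM ?weight_ge0// le_weight// leq_addr.
rewrite (le_trans (psiD x y))// ler_wpM2l// ?mulr_ge0//.
by rewrite ler_pM ?weight_ge0// le_weight// leq_addl.
Qed.

Lemma temperateB phi psi : temperate phi -> temperate psi ->
  temperate (fun x => phi x - psi x).
Proof. by move=> tphi tpsi; apply: temperateD => //; exact: temperateN. Qed.

Lemma temperate_affine (a b : R) phi : temperate phi ->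
  temperate (fun x => phi (b + a * x)).
Proof.
move=> [C [m [C0 phiC]]].
exists (C * `|a| * (2 ^+ m * weight m b * weight m a) ^+ 2), m; split.
  by rewrite mulr_ge0 ?sqr_ge0// mulr_ge0.
have wa x : weight m (b + a * x) <= 2 ^+ m * weight m b * weight m a * weight m x.
  rewrite (le_trans (weightD _ _ _))// -!mulrA ler_wpM2l ?exprn_ge0//.
  by rewrite ler_wpM2l ?weight_ge0// weightM.
move=> x y; rewrite (le_trans (phiC _ _))// opprD addrACA subrr add0r -mulrBr.
rewrite normrM; set K := 2 ^+ m * _ * _.
have -> : C * `|a| * K ^+ 2 * `|x - y| * (weight m x * weight m y) =
   C * (`|a| * `|x - y|) * ((K * weight m x) * (K * weight m y)) by ring.
by rewrite ler_wpM2l ?mulr_ge0// ler_pM ?weight_ge0// wa.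
Qed.

Lemma temperate_sqr : temperate (fun x => x ^+ 2).
Proof.
exists 1, 1%N; split=> // x y; rewrite mul1r subr_sqr normrM ler_wpM2l//.
rewrite (le_trans (ler_normD _ _))//.
rewrite /weight !expr1 -(real_normK (num_real x)) -(real_normK (num_real y)).
move: `|x| `|y| => a b.
have := sqr_ge0 (a - 2^-1); have := sqr_ge0 (b - 2^-1); have := sqr_ge0 (a * b).
lra.
Qed.

Lemma temperate_norm phi : temperate phi -> temperate (fun x => `|phi x|).
Proof.
move=> [C [m [C0 phiC]]]; exists C, m; split=> // x y.
exact: le_trans (ler_dist_dist _ _) (phiC x y).
Qed.

Definition moments mu := forall m, mu.-integrable setT (EFin \o weight m).

Lemma integrable_le_weight mu (h : R -> R) (C : R) m : moments mu ->
  measurable_fun [set: R] h -> (forall x, `|h x| <= C * weight m x) ->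
  mu.-integrable setT (EFin \o h).
Proof.
move=> mmu mh hC.
have iw : mu.-integrable setT (EFin \o (fun x => C * weight m x)).
  by have := integrableZl measurableT C (mmu m).
apply: (le_integrable _ _ _ iw) => //; first exact/measurable_EFinP.
by move=> x _ /=; rewrite lee_fin (le_trans (hC x))// ler_norm.
Qed.

Lemma temperate_integrable mu phi : moments mu -> temperate phi ->
  mu.-integrable setT (EFin \o phi).
Proof.
move=> mmu tphi; have [C [m [C0 phiC]]] := temperate_bound tphi.
by apply: integrable_le_weight phiC => //; exact: temperate_measurable.
Qed.

(** The conditional expectation of [phi] of a sum given all the summands but
    one, as a function of the sum of the others. *)
Definition avg mu (a : R) phi : R -> R := fun x => \int[mu]_y phi (x + a * y).

Lemma avg_integrable mu a phi x : moments mu -> temperate phi ->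
  mu.-integrable setT (EFin \o (fun y => phi (x + a * y))).
Proof. by move=> mmu tphi; apply: temperate_integrable => //; exact: temperate_affine. Qed.

(** The constant grows by a moment of [mu]: weights factor through sums. *)
Lemma temperate_avg mu a phi : moments mu -> temperate phi -> temperate (avg mu a phi).
Proof.
move=> mmu tphi; have [C [m [C0 phiC]]] := tphi.
pose K := 2 ^+ m * weight m a.
have K0 : 0 <= K by rewrite mulr_ge0 ?exprn_ge0 ?weight_ge0.
pose M := \int[mu]_z weight (m + m) z.
exists (C * K ^+ 2 * M), m; split.
  apply: mulr_ge0; first by rewrite mulr_ge0// sqr_ge0.
  by apply: Rintegral_ge0 => x _; exact: weight_ge0.
move=> x y; rewrite /avg -RintegralB//; [|exact: avg_integrable..].
have iB : mu.-integrable setT (EFin \o (fun z => phi (x + a * z) - phi (y + a * z))).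
  by apply: temperate_integrable => //; apply: temperateB; exact: temperate_affine.
rewrite (le_trans (le_normr_Rintegral _ iB))//.
set D := C * `|x - y| * K ^+ 2 * (weight m x * weight m y).
have -> : C * K ^+ 2 * M * `|x - y| * (weight m x * weight m y) = D * M.
  by rewrite /D; ring.
rewrite /M -RintegralZl//.
have wa b z : weight m (b + a * z) <= K * weight m b * weight m z.
  rewrite (le_trans (weightD _ _ _))// /K -!mulrA ler_wpM2l ?exprn_ge0//.
  by rewrite mulrCA ler_wpM2l ?weight_ge0// weightM.
apply: le_Rintegral => //.
- exact: integrable_norm iB.
- by have := integrableZl measurableT D (mmu (m + m)%N).
move=> z _; rewrite (le_trans (phiC _ _))//.
rewrite opprD addrACA subrr addr0 weight_add.
have -> : D * (weight m z * weight m z) =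
  C * `|x - y| * ((K * weight m x * weight m z) * (K * weight m y * weight m z)).
  by rewrite /D; ring.
by rewrite ler_wpM2l ?mulr_ge0// ler_pM ?weight_ge0// wa.
Qed.

End Temperate.

Section Averages.
Context {R : realType}.
Implicit Types (phi psi : R -> R) (mu nu : probability R R).
Local Notation leb := (@lebesgue_measure R).

Lemma Rintegral_prob_cst mu (k : R) : \int[mu]_x k = k.
Proof.
rewrite Rintegral_cst//; transitivity (k * fine (mu setT)); first by [].
by rewrite probability_setT mulr1.
Qed.

Lemma avgE0 mu phi x : avg mu 0 phi x = phi x.
Proof.
by rewrite /avg; under eq_Rintegral do rewrite mul0r addr0; rewrite Rintegral_prob_cst.
Qed.

Lemma avgB mu a phi psi x : moments mu -> temperate phi -> temperate psi ->
  avg mu a (fun y => phi y - psi y) x = avg mu a phi x - avg mu a psi x.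
Proof. by move=> mmu tphi tpsi; rewrite /avg RintegralB//; exact: avg_integrable. Qed.

Lemma avgD mu a phi psi x : moments mu -> temperate phi -> temperate psi ->
  avg mu a (fun y => phi y + psi y) x = avg mu a phi x + avg mu a psi x.
Proof. by move=> mmu tphi tpsi; rewrite /avg RintegralD//; exact: avg_integrable. Qed.

Lemma avgZ mu a k phi x : moments mu -> temperate phi ->
  avg mu a (fun y => k * phi y) x = k * avg mu a phi x.
Proof. by move=> mmu tphi; rewrite /avg RintegralZl//; exact: avg_integrable. Qed.

Lemma avg_shift mu a phi x b : avg mu a (fun y => phi (y + b)) x = avg mu a phi (x + b).
Proof. by apply: eq_Rintegral => y _; rewrite addrAC. Qed.

Lemma measurable_line (c k : R) : measurable_fun [set: R] (fun z => c + k * z).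
Proof. by apply: measurable_funD => //; exact: measurable_funM. Qed.

(** Fubini's theorem: the order in which summands are averaged out is
    immaterial. *)
Lemma avg_comm mu nu a b phi x : moments mu -> moments nu -> temperate phi ->
  avg mu a (avg nu b phi) x = avg nu b (avg mu a phi) x.
Proof.
move=> mmu mnu tphi.
pose h (z : R * R) : \bar R := (phi (x + a * z.1 + b * z.2))%:E.
have mh : measurable_fun setT h.
  apply/measurable_EFinP; apply: (measurableT_comp (temperate_measurable tphi)).
  by repeat apply: measurable_funD => //; apply: measurable_funM.
have [C [m [C0 phiC]]] := temperate_bound tphi.
pose D := C * 2 ^+ m * (2 ^+ m * weight m x * weight m a) * weight m b.
have D0 : 0 <= D by do !apply: mulr_ge0; rewrite ?weight_ge0 ?exprn_ge0.
have hD y z : `|phi (x + a * y + b * z)| <= D * weight m y * weight m z.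
  rewrite (le_trans (phiC _))// /D -!mulrA ler_wpM2l//.
  rewrite (le_trans (weightD _ _ _))// ler_wpM2l ?exprn_ge0//.
  have w1 : weight m (x + a * y) <= 2 ^+ m * (weight m x * (weight m a * weight m y)).
    by rewrite (le_trans (weightD _ _ _))// ler_wpM2l ?exprn_ge0// ler_wpM2l ?weight_ge0// weightM.
  rewrite (le_trans (ler_pM (weight_ge0 _ _) (weight_ge0 _ _) w1 (weightM m b z)))//.
  by rewrite le_eqVlt; apply/orP; left; apply/eqP; ring.
have ih : (mu \x nu)%E.-integrable setT h.
  apply/integrable12ltyP => //.
  apply: (@le_lt_trans _ _ (\int[mu]_y (D * (\int[nu]_z weight m z) * weight m y)%:E)%E).
    apply: ge0_le_integral => //.
    - by move=> y _; apply: integral_ge0.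
    - apply: (@measurable_fun_fubini_tonelli_F _ _ _ _ _ _ (fun z => `|h z|%E)) => //.
      exact: measurableT_comp.
    - apply/measurable_EFinP; apply: measurable_funM => //; exact: measurable_weight.
    move=> y _; have -> : D * (\int[nu]_z weight m z) * weight m y =
        \int[nu]_z (D * weight m y * weight m z).
      by rewrite RintegralZl//; ring.
    have iw : nu.-integrable setT (EFin \o (fun z => D * weight m y * weight m z)).
      by have := integrableZl measurableT (D * weight m y) (mnu m).
    rewrite fineK; last exact: integrable_fin_num iw.
    apply: ge0_le_integral => //.
    - apply: measurableT_comp => //; apply/measurable_EFinP.
      apply: (measurableT_comp (temperate_measurable tphi)).
      exact: (measurable_line (x + a * y) b).
    - by apply/measurable_EFinP; apply: measurable_funM => //; exact: measurable_weight.
    - by move=> z _; rewrite /h /= lee_fin.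
  set M := \int[nu]_z _.
  have iw : mu.-integrable setT (EFin \o (fun y => D * M * weight m y)).
    by have := integrableZl measurableT (D * M) (mmu m).
  by have := integrable_fin_num measurableT iw; rewrite fin_numE lt_neqAle leey andbT => /andP[].
have := Fubini ih; rewrite /h /= => F.
rewrite /avg /Rintegral; congr fine.
transitivity (\int[mu]_y \int[nu]_z (phi (x + a * y + b * z))%:E)%E.
  apply: eq_integral => y _; rewrite fineK//.
  by apply: integrable_fin_num => //; exact: avg_integrable.
rewrite F; apply: eq_integral => z _.
rewrite fineK; last by apply: integrable_fin_num => //; exact: avg_integrable.
by apply: eq_integral => y _; rewrite addrAC.
Qed.

End Averages.

(** * Laws with an even unimodal density *)
Section Bell.
Context {R : realType}.
Implicit Types (phi psi : R -> R) (mu nu : probability R R).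
Local Notation leb := (@lebesgue_measure R).

(** The last condition says that [f] is even and unimodal at once. *)
Definition bell_density mu (f : R -> R) := [/\ measurable_fun [set: R] f,
  forall x, 0 <= f x,
  forall A, measurable A -> mu A = (\int[leb]_(x in A) (f x)%:E)%E &
  forall x y, `|x| <= `|y| -> f y <= f x].

Lemma integrable_density mu f h : bell_density mu f ->
  mu.-integrable setT (EFin \o h) ->
  leb.-integrable setT (EFin \o (fun x => h x * f x)).
Proof.
move=> [mf f0 muf _] /integrableP[mh ih].
have mh' : measurable_fun [set: R] h by exact/measurable_EFinP.
apply/integrableP; split; first by apply/measurable_EFinP; exact: measurable_funM.
move: ih; rewrite (ge0_integral_density mf f0 muf)//; last exact: measurableT_comp.
apply: le_lt_trans; rewrite le_eqVlt; apply/orP; left; apply/eqP.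
by apply: eq_integral => x _ /=; rewrite normrM EFinM (ger0_norm (f0 x)).
Qed.

Lemma integral_density mu f h : bell_density mu f ->
  mu.-integrable setT (EFin \o h) ->
  \int[mu]_x h x = \int[leb]_x (h x * f x).
Proof.
move=> bf ih; have ihf := integrable_density bf ih; case: bf => mf f0 muf _.
have mh : measurable_fun setT (EFin \o h) by case/integrableP : ih.
rewrite /Rintegral; congr fine; rewrite [LHS]integralE [RHS]integralE.
rewrite (ge0_integral_density mf f0 muf (measurable_funepos mh))//.
rewrite (ge0_integral_density mf f0 muf (measurable_funeneg mh))//.
congr (_ - _)%E; apply: eq_integral => x _.
  by rewrite [in LHS]funeposE [in RHS]funeposE/= maxe_pMl ?lee_fin// mul0e ?EFinM.
rewrite [in LHS]funenegE [in RHS]funenegE maxe_pMl ?lee_fin// mul0e; congr (maxe _ _).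
by rewrite [in RHS]EFinM mulNe.
Qed.

Lemma bell_even mu f x : bell_density mu f -> f (- x) = f x.
Proof. by move=> [_ _ _ fle]; apply/eqP; rewrite eq_le !fle// normrN. Qed.

Lemma bell_avgN mu f a phi x : bell_density mu f -> moments mu -> temperate phi ->
  avg mu (- a) phi x = avg mu a phi x.
Proof.
move=> bf mmu tphi; rewrite /avg.
rewrite (integral_density bf (avg_integrable (- a) x mmu tphi)).
rewrite (integral_density bf (avg_integrable a x mmu tphi)).
have i := integrable_density bf (avg_integrable a x mmu tphi).
rewrite (@integral_affine _ (-1) 0 _ _ i); last by rewrite oppr_eq0 oner_eq0.
rewrite normrN1 mul1r; apply: eq_Rintegral => y _.
by rewrite addr0 mulN1r (bell_even _ bf) mulrN mulNr.
Qed.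

(** Since [mu] is even, the difference of the averages is the integral of
    [psi (y + a * t) - psi (x - a * t)]. The reflection of [t] into
    [- t - (y - x) / a] changes the sign of this integrand, and where it is
    nonnegative, [t] is nearer to the mode of [f] than its reflection. *)
Lemma bell_avg_homo mu f a psi : bell_density mu f -> moments mu -> temperate psi ->
  (forall x y, `|x| <= `|y| -> psi x <= psi y) ->
  forall x y, `|x| <= `|y| -> avg mu a psi x <= avg mu a psi y.
Proof.
move=> bf mmu tpsi psile.
have psiN z : psi (- z) = psi z by apply/eqP; rewrite eq_le !psile// normrN.
have avN z : avg mu a psi (- z) = avg mu a psi z.
  rewrite -(bell_avgN _ _ bf mmu tpsi); apply: eq_Rintegral => t _.
  by rewrite -psiN; congr psi; ring.
suff H x y : 0 <= x -> x <= y -> avg mu a psi x <= avg mu a psi y.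
  move=> x y xy.
  have avn z : avg mu a psi z = avg mu a psi `|z|.
    by case: (ger0P z) => _ //; rewrite avN.
  by rewrite (avn x) (avn y) H.
move=> x0 xy; have [->|a0] := eqVneq a 0.
  by rewrite !avgE0 psile// !ger0_norm// (le_trans x0).
rewrite -subr_ge0 -(bell_avgN a x bf mmu tpsi).
pose F t := psi (y + a * t) - psi (x - a * t).
pose d := (y - x) / a.
have ad : a * d = y - x by rewrite /d mulrC divfK.
have tF : temperate F.
  by apply: temperateB; [|under eq_fun do rewrite -mulNr]; exact: temperate_affine.
have iF : mu.-integrable setT (EFin \o F) by exact: temperate_integrable.
have -> : avg mu a psi y - avg mu (- a) psi x = \int[mu]_t F t.
  rewrite /avg -RintegralB//; [|exact: avg_integrable..].
  by apply: eq_Rintegral => t _; rewrite /F mulNr.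
rewrite (integral_density bf iF); have iFf := integrable_density bf iF.
have n10 : (-1 : R) != 0 by rewrite oppr_eq0 oner_eq0.
have iFf' := integrable_affine (- d) n10 iFf.
have E := integral_affine (- d) n10 iFf.
rewrite normrN1 mul1r in E.
rewrite -(@pmulr_rge0 _ 2)// mulr_natl mulr2n {2}E -RintegralD//.
apply: Rintegral_ge0 => t _.
have -> : F (-1 * t - d) = - F t.
  rewrite /F opprB; congr (psi _ - psi _).
    by transitivity (y - a * d - a * t); [ring|rewrite ad; ring].
  by transitivity (x + a * d + a * t); [ring|rewrite ad; ring].
rewrite mulNr -mulrBr.
have [_ _ _ fle] := bf.
have sq (u v : R) : (`|u| <= `|v|) = (u ^+ 2 <= v ^+ 2).
  by rewrite -(real_normK (num_real u)) -(real_normK (num_real v)) ler_sqr ?nnegrE.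
have a2 : 0 < a ^+ 2 by rewrite exprn_even_gt0.
have [le|lt] := leP 0 (y - x + 2 * (a * t)).
  apply: mulr_ge0; rewrite subr_ge0.
    by apply: psile; rewrite sq; nra.
  apply: fle; rewrite sq.
  suff : 0 <= a ^+ 2 * (d * d + 2 * (t * d)) by rewrite pmulr_rge0//; nra.
  have -> : a ^+ 2 * (d * d + 2 * (t * d)) = (a * d) * (a * d) + 2 * ((a * t) * (a * d)) by ring.
  by rewrite ad; nra.
rewrite -mulrNN; apply: mulr_ge0; rewrite oppr_ge0 subr_le0.
  by apply: psile; rewrite sq; nra.
apply: fle; rewrite sq.
suff : a ^+ 2 * (d * d + 2 * (t * d)) <= 0 by rewrite pmulr_rle0//; nra.
have -> : a ^+ 2 * (d * d + 2 * (t * d)) = (a * d) * (a * d) + 2 * ((a * t) * (a * d)) by ring.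
  by rewrite ad; nra.
Qed.

End Bell.

(** * Functions of rising curvature *)
Section RisingCurvature.
Context {R : realType}.
Implicit Types (phi h : R -> R) (mu : probability R R).

Definition sdiff phi (s x : R) := phi (x + s) + phi (x - s) - 2 * phi x.

Lemma temperate_sdiff phi s : temperate phi -> temperate (sdiff phi s).
Proof.
move=> tphi; have sh b : temperate (fun x => phi (x + b)).
  have := temperate_affine 1 b tphi.
  by under eq_fun do rewrite mul1r addrC.
by apply: temperateB; [apply: temperateD|apply: temperateZ].
Qed.

Lemma sdiff_avg mu a phi s x : moments mu -> temperate phi ->
  sdiff (avg mu a phi) s x = avg mu a (sdiff phi s) x.
Proof.
move=> mmu tphi; have sh b : temperate (fun x => phi (x + b)).
  have := temperate_affine 1 b tphi.
  by under eq_fun do rewrite mul1r addrC.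
rewrite /sdiff avgB//; [|exact: temperateD|exact: temperateZ].
by rewrite avgD// avgZ// !avg_shift.
Qed.

(** Second differences replace the second derivative, which [`|x| `^ p] does
    not have at 0 when [p < 2]; they also commute with averaging. *)
Definition rising_curvature phi := [/\ temperate phi, forall x, phi (- x) = phi x &
  forall s x y, `|x| <= `|y| -> sdiff phi s x <= sdiff phi s y].

(** The second differences of an average are averages of functions increasing
    in [`|x|], to which [bell_avg_homo] applies. *)
Lemma rising_curvature_avg mu f a phi : bell_density mu f -> moments mu ->
  rising_curvature phi -> rising_curvature (avg mu a phi).
Proof.
move=> bf mmu [tphi phiN rphi]; split; first exact: temperate_avg.
  move=> x; rewrite -(bell_avgN _ _ bf mmu tphi); apply: eq_Rintegral => t _.
  by rewrite -phiN; congr phi; ring.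
move=> s x y xy; rewrite !sdiff_avg//.
apply: (bell_avg_homo a bf mmu) => //; first exact: temperate_sdiff.
exact: rphi.
Qed.

Lemma rising_curvature_sqr (k : R) : rising_curvature (fun x => k * x ^+ 2).
Proof.
split; first exact: temperateZ temperate_sqr.
  by move=> x; rewrite sqrrN.
by move=> s x y _; rewrite /sdiff le_eqVlt; apply/orP; left; apply/eqP; ring.
Qed.

Lemma rising_curvature_dilate (k : R) phi : rising_curvature phi ->
  rising_curvature (fun x => phi (k * x)).
Proof.
move=> [tphi phiN rphi]; split.
- by have := temperate_affine k 0 tphi; under eq_fun do rewrite add0r.
- by move=> x; rewrite mulrN phiN.
move=> s x y xy; have := rphi (k * s) (k * x) (k * y).
by rewrite /sdiff !mulrDr mulrN; apply; rewrite !normrM ler_wpM2l.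
Qed.

(** Convexity in the square. Subtract the interpolating [A + B t ^ 2]: if the
    difference [w] were positive between its zeros [x] and [z], its second
    differences would be negative at an interior maximum [c] of a small
    perturbation, hence all over [[-c, c]], which forbids the minimum that [w]
    must have there. *)
Lemma rising_curvature_convex_sqr h x y z : rising_curvature h ->
  0 <= x -> x < y -> y < z ->
  h y * (z ^+ 2 - x ^+ 2) <= h x * (z ^+ 2 - y ^+ 2) + h z * (y ^+ 2 - x ^+ 2).
Proof.
move=> [th hN rh] x0 xy yz; rewrite leNgt; apply/negP => bad.
have xz2 : 0 < z ^+ 2 - x ^+ 2 by nra.
pose B := (h z - h x) / (z ^+ 2 - x ^+ 2).
pose w t := h t - h x - B * (t ^+ 2 - x ^+ 2).
have ch := temperate_continuous th.
have cw : continuous w.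
  apply: temperate_continuous; apply: temperateB; first apply: temperateB => //.
    exact: temperate_cst.
  by apply: temperateZ; apply: temperateB; [exact: temperate_sqr|exact: temperate_cst].
have wx : w x = 0 by rewrite /w; ring.
have wz : w z = 0 by rewrite /w /B divfK ?gt_eqF//; ring.
have wy : 0 < w y.
  have -> : w y = (h y * (z ^+ 2 - x ^+ 2) -
      (h x * (z ^+ 2 - y ^+ 2) + h z * (y ^+ 2 - x ^+ 2))) / (z ^+ 2 - x ^+ 2).
    by rewrite /w /B; field; rewrite gt_eqF.
  by rewrite divr_gt0// subr_gt0.
have wN t : w (- t) = w t by rewrite /w hN sqrrN.
have rw s t u : `|t| <= `|u| -> sdiff w s t <= sdiff w s u.
  move=> /(rh s); have E v : sdiff w s v = sdiff h s v - 2 * B * s ^+ 2.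
    by rewrite /sdiff /w; ring.
  by rewrite !E lerD2r.
pose e := w y / (2 * z ^+ 2).
have z2 : 0 < z ^+ 2 by nra.
have e0 : 0 < e by rewrite /e divr_gt0// mulr_gt0.
have ez : e * z ^+ 2 = w y / 2 by rewrite /e; field; rewrite gt_eqF//; lra.
pose v t := w t + e * t ^+ 2.
have cv : {within `[x, z], continuous v}.
  apply: continuous_subspaceT => t; apply: cvgD; first exact: cw.
  by apply: cvgM; [exact: cvg_cst|exact: exprn_continuous].
have [|c cxz vc] := EVT_max _ cv; first by rewrite (le_trans (ltW xy))// ltW.
have vcy : v y <= v c by apply: vc; rewrite in_itv/= !ltW.
have vcz : v z < v c.
  by apply: lt_le_trans vcy; rewrite /v wz ez add0r; nra.
have vcx : v x < v c by apply: le_lt_trans vcz; rewrite /v wx wz; nra.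
have [xc cz] : x < c /\ c < z.
  move: cxz; rewrite in_itv/= !le_eqVlt => /andP[/predU1P[E|->] /predU1P[E'|->]//];
    by [move: vcx; rewrite -E ltxx|move: vcz; rewrite E' ltxx|move: vcx; rewrite E ltxx].
have wc : 0 < w c.
  have cz2 : c ^+ 2 <= z ^+ 2 by nra.
  have := ler_wpM2l (ltW e0) cz2.
  by move: vcz; rewrite /v wz; lra.
pose s0 := Num.min (c - x) (z - c).
have s00 : 0 < s0 by rewrite lt_min !subr_gt0 xc.
(* At [c] the maximality of [v] gives [sdiff v s c <= 0], and [sdiff w s c] is
   smaller by [2 * e * s ^+ 2]; rising curvature spreads this to [[-c, c]]. *)
have neg s t : 0 < s -> s <= s0 -> `|t| <= c -> sdiff w s t < 0.
  move=> sp; rewrite le_min => /andP[s1 s2] tc.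
  have c0 : 0 <= c by rewrite (le_trans x0)// ltW.
  rewrite (le_lt_trans (rw s t c _)) ?(ger0_norm c0)//.
  have v1 : v (c + s) <= v c by apply: vc; rewrite in_itv/=; apply/andP; split; lra.
  have v2 : v (c - s) <= v c by apply: vc; rewrite in_itv/=; apply/andP; split; lra.
  have es : 0 < e * s ^+ 2 by rewrite mulr_gt0// exprn_gt0.
  by move: v1 v2; rewrite /v /sdiff; nra.
have c0 : 0 < c by rewrite (le_lt_trans x0).
(* The minimum over [[-c, c]], by evenness, is at some [m] in [0, c[. *)
have [|m] := @EVT_min R w 0 c (ltW c0); first exact: continuous_subspaceT.
rewrite in_itv/= => /andP[m0 mc] wm.
have wmx : w m <= w x by apply: wm; rewrite in_itv/= x0 ltW.
have {}mc : m < c.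
  by rewrite lt_neqAle mc andbT; apply/eqP => E; move: wmx; rewrite E wx; lra.
pose s := Num.min s0 (c - m).
have sp : 0 < s by rewrite lt_min s00 subr_gt0.
have ss0 : s <= s0 by rewrite ge_min lexx.
have scm : s <= c - m by rewrite ge_min lexx orbT.
have := neg s m sp ss0; rewrite ger0_norm// => /(_ (ltW mc)).
apply/negP; rewrite -leNgt /sdiff.
have w1 : w m <= w (m + s) by apply: wm; rewrite in_itv/=; apply/andP; split; lra.
have w2 : w m <= w (m - s).
  have -> : w (m - s) = w `|m - s| by case: (ger0P (m - s)); rewrite ?wN.
  by apply: wm; rewrite in_itv/= normr_ge0/= ler_norml; apply/andP; split; lra.
by lra.
Qed.

End RisingCurvature.

(** * Comparison of two densities that cross twice *)
Section Crossing.
Context {R : realType}.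
Implicit Types (phi h k f g : R -> R) (mu nu : probability R R).
Local Notation leb := (@lebesgue_measure R).

Lemma ae_off_abs (al : R) (Q : R -> Prop) :
  (forall y, `|y| != al -> Q y) -> {ae leb, forall y, Q y}.
Proof.
move=> H; exists [set al; - al]; split.
- exact: measurableU.
- apply: countable_lebesgue_measure0; apply: finite_set_countable; exact: finite_set2.
move=> y /= nQ; apply: contrapT => /not_orP[ya yna]; apply: nQ; apply: H.
by apply/eqP; case: (ger0P y) => _ E; [apply: ya|apply: yna]; rewrite -E// opprK.
Qed.

(** Every [A + B x ^+ 2] has the same integral under both laws, hence integral
    0 against [g - f]. By assumption the points [0 <= y] with [g y < f y] form
    an interval. When it is bounded and not reduced to a point, [k] minus its
    chord through the two ends, as a function of the square, has the sign of
    [g - f] ([chord]). Otherwise some [A + B y ^+ 2] already has that sign and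
    vanishes at most at one [y], which forces [f] and [g] to agree almost
    everywhere ([equal]). *)
Lemma crossing_le mu nu f g k : bell_density mu f -> bell_density nu g ->
  moments mu -> moments nu ->
  \int[mu]_x (x ^+ 2) = \int[nu]_x (x ^+ 2) ->
  (forall x y z, 0 <= x -> x < y -> y < z -> g x < f x -> g z < f z -> g y < f y) ->
  rising_curvature k ->
  \int[mu]_x k x <= \int[nu]_x k x.
Proof.
move=> bf bg mmu mnu mom2 ocvx rk; have [tk kN _] := rk.
have tL (A B : R) : temperate (fun y => A + B * y ^+ 2).
  by apply: temperateD; [exact: temperate_cst|apply: temperateZ; exact: temperate_sqr].
have diffE h : temperate h ->
    \int[nu]_x h x - \int[mu]_x h x = \int[leb]_x (h x * (g x - f x)).
  move=> th; rewrite (integral_density bf (temperate_integrable mmu th)).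
  rewrite (integral_density bg (temperate_integrable mnu th)) -RintegralB//.
  - by apply: eq_Rintegral => x _; rewrite mulrBr.
  - exact: integrable_density bg (temperate_integrable mnu th).
  - exact: integrable_density bf (temperate_integrable mmu th).
have intL (A B : R) : \int[nu]_x (A + B * x ^+ 2) = \int[mu]_x (A + B * x ^+ 2).
  rewrite !RintegralD//; last 4 first.
  - exact: temperate_integrable (temperate_cst A).
  - exact: temperate_integrable (temperateZ _ temperate_sqr).
  - exact: temperate_integrable (temperate_cst A).
  - exact: temperate_integrable (temperateZ _ temperate_sqr).
  rewrite !Rintegral_prob_cst !RintegralZl// ?mom2//; exact: temperate_integrable temperate_sqr.
have fN := bell_even _ bf; have gN := bell_even _ bg.
have absE y : [/\ k y = k `|y|, f y = f `|y|, g y = g `|y| & y ^+ 2 = `|y| ^+ 2].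
  by case: (ger0P y) => _; split; rewrite ?kN ?fN ?gN ?sqrrN.
have chord (A B : R) : (forall y, 0 <= y -> 0 <= (k y - (A + B * y ^+ 2)) * (g y - f y)) ->
    \int[mu]_x k x <= \int[nu]_x k x.
  move=> H; have := diffE _ (temperateB tk (tL A B)).
  rewrite !RintegralB//; [|exact: temperate_integrable..].
  rewrite intL -subr_ge0 => E.
  have -> : \int[nu]_x k x - \int[mu]_x k x =
    \int[nu]_x k x - \int[mu]_x (A + B * x ^+ 2) -
    (\int[mu]_x k x - \int[mu]_x (A + B * x ^+ 2)) by ring.
  rewrite E; apply: Rintegral_ge0 => y _.
  by have [-> -> -> ->] := absE y; exact: H.
have equal (A B al : R) : (forall y, 0 <= y -> y != al ->
    A + B * y ^+ 2 != 0 /\ 0 <= (A + B * y ^+ 2) * (g y - f y)) ->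
    \int[mu]_x k x <= \int[nu]_x k x.
  move=> H; rewrite le_eqVlt; apply/orP; left.
  pose F y := (A + B * y ^+ 2) * (g y - f y).
  have Hab y : `|y| != al -> A + B * y ^+ 2 != 0 /\ 0 <= F y.
    by rewrite /F; have [_ -> -> ->] := absE y; exact: H.
  have [mf f0 _ _] := bf; have [mg g0 _ _] := bg.
  have mF : measurable_fun [set: R] F.
    apply: measurable_funM; last exact: measurable_funB.
    exact: temperate_measurable (tL A B).
  have F0 : \int[leb]_x F x = 0 by rewrite -diffE// intL subrr.
  have iF : leb.-integrable setT (EFin \o F).
    have th := tL A B.
    have i1 := integrable_density bf (temperate_integrable mmu th).
    have i2 := integrable_density bg (temperate_integrable mnu th).
    have := integrableB measurableT i2 i1; apply: eq_integrable => // x _ /=.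
    by rewrite -EFinB -mulrBr.
  have F0' : (\int[leb]_x `|(F x)%:E| = 0)%E.
    rewrite (@ae_eq_integral _ _ _ leb setT (EFin \o F))//.
    - by rewrite -[RHS]/(0%:E) -F0 fineK// integrable_fin_num.
    - by apply: measurableT_comp => //; exact/measurable_EFinP.
    - exact/measurable_EFinP.
    by apply: (ae_off_abs (al := al)) => y /Hab[_ Fy] _ /=; rewrite ger0_norm.
  have mEF : measurable_fun [set: R] (EFin \o F) by exact/measurable_EFinP.
  have Fae := (ae_eq_integral_abs leb measurableT mEF).1 F0'.
  apply/eqP/esym/eqP; rewrite -subr_eq0 diffE//; apply/eqP.
  rewrite /Rintegral (@ae_eq_integral _ _ _ leb setT (cst 0%E))//.
  - by rewrite integral0.
  - apply/measurable_EFinP; apply: measurable_funM; first exact: temperate_measurable.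
    exact: measurable_funB.
  have nz := @ae_off_abs al (fun y => A + B * y ^+ 2 != 0) (fun y ny => (Hab y ny).1).
  apply: (filterS2 _ _ Fae nz) => y Fy ny _ /=; congr EFin.
  by move: (Fy I) => /= [] /eqP; rewrite /F mulf_eq0 (negbTE ny)/= => /eqP ->; rewrite mulr0.
pose D := [set y : R | 0 <= y /\ g y < f y].
have sgn y : 0 <= y -> ~ D y -> 0 <= g y - f y.
  by move=> y0 nD; rewrite subr_ge0 leNgt; apply/negP => ?; exact: nD.
(* The interval [D] is empty or a point: [g - f] is nonnegative elsewhere. *)
have [[al Dal]|noD] := pselect (exists al, forall y, D y -> y = al).
  apply: (@equal 1 0 al) => y y0 yal; rewrite mul0r addr0 oner_neq0 mul1r; split=> //.
  by apply: sgn => // /Dal /eqP; rewrite (negbTE yal).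
have [p Dp] : D !=set0.
  by apply: contrapT => D0; apply: noD; exists 0 => y Dy; case: D0; exists y.
have lbD : has_inf D by split; [exists p|exists 0 => y []].
pose al := inf D.
have al0 : 0 <= al by apply: lb_le_inf; [exists p|move=> y []].
have below y : 0 <= y -> y < al -> ~ D y.
  by move=> y0 yal Dy; move: yal; rewrite ltNge => /negP; apply; apply: ge_inf => //; case: lbD.
have gtal y : al < y -> exists2 x, D x & x < y by move=> /(inf_lt (ex_intro _ p Dp))[x]; exists x.
(* If [D] is a half-line from [al], then [al ^+ 2 - y ^+ 2] has the sign of
   [g - f]. *)
have [hub|nub] := pselect (has_ubound D); last first.
  have above y : al < y -> D y.
    move=> aly; have [x Dx xy] := gtal _ aly.
    have [z Dz yz] : exists2 z, D z & y < z.
      apply: contrapT => H; apply: nub; exists y => z Dz; rewrite leNgt; apply/negP => yz.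
      by apply: H; exists z.
    split; first by rewrite (le_trans al0)// ltW.
    by case: Dx Dz => x0 gx [_ gz]; exact: (ocvx x y z).
  apply: (@equal (al ^+ 2) (-1) al) => y y0; rewrite mulN1r neq_lt => /orP[yal|aly].
    split; first by apply: lt0r_neq0; rewrite subr_gt0; nra.
    by apply: mulr_ge0; [rewrite subr_ge0; nra|exact: sgn (below _ _ _)].
  split; first by apply: ltr0_neq0; rewrite subr_lt0; nra.
  have [_ gf] := above _ aly.
  by rewrite -mulrNN; apply: mulr_ge0; rewrite oppr_ge0; [nra|rewrite subr_le0 ltW].
have sD : has_sup D by split=> //; exists p.
pose be := sup D.
have above y : be < y -> ~ D y.
  by move=> bey Dy; move: bey; rewrite ltNge => /negP; apply; exact: ub_le_sup.
have ltbe y : y < be -> exists2 x, D x & y < x by move=> /(sup_gt (ex_intro _ p Dp))[x]; exists x.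
have albe : al < be.
  rewrite ltNge; apply/negP => beal; apply: noD; exists al => y Dy; apply/eqP.
  rewrite eq_le; apply/andP; split; first by rewrite (le_trans _ beal)//; exact: ub_le_sup.
  by apply: ge_inf => //; case: lbD.
have ab2 : 0 < be ^+ 2 - al ^+ 2 by nra.
pose B := (k be - k al) / (be ^+ 2 - al ^+ 2).
have Bk : B * (be ^+ 2 - al ^+ 2) = k be - k al by rewrite /B divfK// gt_eqF.
apply: (@chord (k al - B * al ^+ 2) B) => y y0.
have cvx := rising_curvature_convex_sqr rk.
have [yal|aly|->] := ltgtP y al.
- apply: mulr_ge0; last by apply: sgn => //; exact: below.
  have := cvx y al be y0 yal albe.
  suff -> : k y - (k al - B * al ^+ 2 + B * y ^+ 2) =
    (k y * (be ^+ 2 - al ^+ 2) + k be * (al ^+ 2 - y ^+ 2) - k al * (be ^+ 2 - y ^+ 2)) / (be ^+ 2 - al ^+ 2).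
    by move=> ?; rewrite divr_ge0//; [rewrite subr_ge0|exact: ltW].
  by rewrite /B; field; rewrite gt_eqF.
- have [ybe|bey|->] := ltgtP y be.
  + have [x [x0 gx] xy] := gtal _ aly; have [z [_ gz] yz] := ltbe _ ybe.
    have gfy := ocvx x y z x0 xy yz gx gz.
    rewrite -mulrNN; apply: mulr_ge0; rewrite oppr_ge0; last by rewrite subr_le0 ltW.
    have := cvx al y be al0 aly ybe.
    suff -> : k y - (k al - B * al ^+ 2 + B * y ^+ 2) =
      (k y * (be ^+ 2 - al ^+ 2) - (k al * (be ^+ 2 - y ^+ 2) + k be * (y ^+ 2 - al ^+ 2))) / (be ^+ 2 - al ^+ 2).
      by move=> ?; rewrite pmulr_lle0 ?invr_gt0// subr_le0.
    by rewrite /B; field; rewrite gt_eqF.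
  + apply: mulr_ge0; last by apply: sgn => //; exact: above.
    have := cvx al be y al0 albe bey.
    suff -> : k y - (k al - B * al ^+ 2 + B * y ^+ 2) =
      (k al * (y ^+ 2 - be ^+ 2) + k y * (be ^+ 2 - al ^+ 2) - k be * (y ^+ 2 - al ^+ 2)) / (be ^+ 2 - al ^+ 2).
      by move=> ?; rewrite divr_ge0//; [rewrite subr_ge0|exact: ltW].
    by rewrite /B; field; rewrite gt_eqF.
  + have -> : k be - (k al - B * al ^+ 2 + B * be ^+ 2) = 0.
      by transitivity (k be - k al - B * (be ^+ 2 - al ^+ 2)); [ring|rewrite Bk subrr].
    by rewrite mul0r.
- by rewrite subrK subrr mul0r.
Qed.

End Crossing.

(** * The Gaussian law and its moments *)
Section Gaussian.
Context {R : realType}.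
Implicit Types (phi h k f g : R -> R) (mu nu : probability R R).
Local Notation leb := (@lebesgue_measure R).

(** Apply [1 + u <= expR u] to a small multiple [u] of [x ^+ 2], chosen so that
    the [m]-th power stays below the exponential. *)
Lemma weight_le_expR m (b x : R) : 0 < b ->
  weight m x <= (1 + 2 * m.+1%:R / b) ^+ m * expR (b * x ^+ 2 / 2).
Proof.
move=> b0; set c := _ / b; have c0 : 0 < c by rewrite divr_gt0// mulr_gt0.
have cE : c^-1 = b / (2 * m.+1%:R) by rewrite /c invf_div.
have u0 : 0 <= x ^+ 2 by exact: sqr_ge0.
have cu0 : 0 <= c^-1 * x ^+ 2 by rewrite mulr_ge0// invr_ge0 ltW.
apply: (@le_trans _ _ ((1 + c) ^+ m * expR (c^-1 * x ^+ 2) ^+ m)).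
  rewrite /weight -exprMn lerXn2r ?nnegrE ?addr_ge0//.
    by rewrite mulr_ge0 ?expR_ge0// addr_ge0// ltW.
  apply: (@le_trans _ _ ((1 + c) * (1 + c^-1 * x ^+ 2))).
    have -> : (1 + c) * (1 + c^-1 * x ^+ 2) = 1 + x ^+ 2 + (c + c^-1 * x ^+ 2).
      by field; rewrite gt_eqF.
    by rewrite lerDl addr_ge0// ltW.
  by rewrite ler_wpM2l ?expR_ge1Dx// addr_ge0// ltW.
rewrite ler_wpM2l ?exprn_ge0 ?addr_ge0 ?(ltW c0)// -expRM_natl ler_expR cE.
rewrite -[leRHS]mulr1 (_ : m%:R * _ = b * x ^+ 2 / 2 * (m%:R / m.+1%:R)); last first.
  by field.
rewrite ler_wpM2l//; first by rewrite divr_ge0// mulr_ge0// ltW.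
by rewrite ler_pdivrMr// mul1r ler_nat.
Qed.

Lemma integrable_expR_sqr (b : R) : 0 < b ->
  leb.-integrable setT (EFin \o (fun x => expR (- (b * x ^+ 2)))).
Proof.
move=> b0; pose s := Num.sqrt (2 * b)^-1.
have b20 : 0 < (2 * b)^-1 by rewrite invr_gt0 mulr_gt0.
have s0 : s != 0 by rewrite gt_eqF// sqrtr_gt0.
have := integrableZl measurableT (normal_peak s)^-1 (integrable_normal_pdf 0 s).
apply: eq_integrable => // x _; rewrite normal_pdfE//= -EFinM; congr EFin.
rewrite mulrA mulVf ?mul1r; last by rewrite gt_eqF// normal_peak_gt0.
rewrite /normal_fun subr0 sqr_sqrtr ?ltW//; congr expR.
by field; rewrite gt_eqF.
Qed.

Lemma moments_of_density mu f (C b : R) : bell_density mu f -> 0 < b ->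
  (forall x, f x <= C * expR (- (b * x ^+ 2))) -> moments mu.
Proof.
move=> [mf f0 muf _] b0 fC m; apply/integrableP; split.
  by apply/measurable_EFinP; exact: measurable_weight.
rewrite (ge0_integral_density mf f0 muf)//; last first.
  by apply: measurableT_comp => //; apply/measurable_EFinP; exact: measurable_weight.
have b20 : 0 < b / 2 by rewrite divr_gt0.
have C0 : 0 <= C.
  by have := le_trans (f0 0) (fC 0); rewrite expr0n mulr0 oppr0 expR0 mulr1.
pose K := (1 + 2 * m.+1%:R / b) ^+ m * C.
have /integrableP[_] := integrableZl measurableT K (integrable_expR_sqr b20).
apply: le_lt_trans; apply: ge0_le_integral => //.
- by move=> x _; rewrite mule_ge0// lee_fin.
- apply: emeasurable_funM; last exact/measurable_EFinP.
  by apply: measurableT_comp => //; apply/measurable_EFinP; exact: measurable_weight.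
- apply: measurableT_comp => //; apply: emeasurable_funM => //.
  by case/integrableP : (integrable_expR_sqr b20).
move=> x _ /=; rewrite lee_fin (ger0_norm (weight_ge0 _ _)).
rewrite (le_trans _ (ler_norm _))//.
apply: (@le_trans _ _ ((1 + 2 * m.+1%:R / b) ^+ m * expR (b * x ^+ 2 / 2) *
    (C * expR (- (b * x ^+ 2))))).
  by rewrite ler_pM ?weight_ge0 ?weight_le_expR.
rewrite /K mulrACA -expRD le_eqVlt; apply/orP; left; apply/eqP.
by congr (_ * expR _); lra.
Qed.

(** The normal law is a measure on the copy of [R] that carries Lebesgue
    measure; [gauss] transports it along this identity map. *)
Definition idR (x : measurableTypeR R) : R := x.

Lemma measurable_idR : measurable_fun setT idR.
Proof. exact: measurable_id. Qed.

HB.instance Definition _ := isMeasurableFun.Build _ _ _ _ idR measurable_idR.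

Definition gauss (s : R) : probability R R :=
  distribution (normal_prob 0 s) (idR : {mfun measurableTypeR R >-> R}).

Lemma bell_gauss s : 0 < s -> bell_density (gauss s) (normal_pdf 0 s).
Proof.
move=> s0; split.
- exact: measurable_normal_pdf.
- by move=> x; exact: normal_pdf_ge0.
- by [].
move=> x y xy; rewrite normal_pdfE ?gt_eqF// ler_wpM2l ?normal_peak_ge0//.
rewrite /normal_fun !subr0 ler_expR ler_wpM2r ?invr_ge0 ?mulrn_wge0 ?sqr_ge0//.
by rewrite lerN2 -(real_normK (num_real x)) -(real_normK (num_real y)) ler_sqr ?nnegrE.
Qed.

Lemma moments_gauss s : 0 < s -> moments (gauss s).
Proof.
move=> s0; apply: (@moments_of_density _ _ (normal_peak s) (2 * s ^+ 2)^-1 (bell_gauss s0)).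
  by rewrite invr_gt0 mulr_gt0// exprn_gt0.
move=> x; rewrite normal_pdfE ?gt_eqF// ler_wpM2l ?normal_peak_ge0//.
rewrite /normal_fun subr0 le_eqVlt; apply/orP; left; apply/eqP; congr expR.
by field; rewrite gt_eqF.
Qed.

Lemma normal_pdf_scale s x : 0 < s -> s * normal_pdf 0 s (s * x) = normal_pdf 0 1 x :> R.
Proof.
move=> s0; rewrite !normal_pdfE ?gt_eqF// /normal_peak /normal_fun !subr0.
rewrite expr1n mul1r -mulrnAr sqrtrM ?sqr_ge0// sqrtr_sqr gtr0_norm//.
rewrite invfM !mulrA divff ?mul1r ?gt_eqF//; congr (_ * expR _).
by field; rewrite gt_eqF.
Qed.

Lemma integral_gauss_scale s h : 0 < s -> temperate h ->
  \int[gauss s]_x h x = \int[gauss 1]_x h (s * x).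
Proof.
move=> s0 th; have ths : temperate (fun x => h (s * x)).
  by have := temperate_affine s 0 th; under eq_fun do rewrite add0r.
have i1 := temperate_integrable (moments_gauss s0) th.
have i2 := temperate_integrable (moments_gauss ltr01) ths.
rewrite (integral_density (bell_gauss s0) i1) (integral_density (bell_gauss ltr01) i2).
rewrite (@integral_affine _ s 0) ?gt_eqF//; last exact: integrable_density (bell_gauss s0) i1.
rewrite gtr0_norm// -RintegralZl//; last first.
  by apply: (integrable_affine 0 _ (integrable_density (bell_gauss s0) i1)); rewrite gt_eqF.
by apply: eq_Rintegral => x _; rewrite addr0 mulrCA normal_pdf_scale.
Qed.

Lemma avg_gaussE (a x : R) phi : temperate phi -> (forall y, 0 <= phi y) ->
  (avg (gauss 1) a phi x)%:E = (\int[leb]_y (phi (x + a * y) * normal_pdf 0 1 y)%:E)%E.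
Proof.
move=> tphi phi0; rewrite /avg fineK; last first.
  by apply: integrable_fin_num => //; apply: avg_integrable => //; exact: moments_gauss.
have [mf f0 muf _] := bell_gauss ltr01.
rewrite (ge0_integral_density mf f0 muf)//; last by move=> y; rewrite lee_fin.
by apply/measurable_EFinP; apply: temperate_measurable; exact: temperate_affine.
Qed.

(** Rotation invariance of the standard Gaussian pair: the substitution that
    turns [s y + t z] into [r u] maps the product density to itself. *)
Lemma gauss_semigroup_ge0 (s t r x : R) phi : temperate phi -> (forall y, 0 <= phi y) ->
  s != 0 -> 0 < r -> r ^+ 2 = s ^+ 2 + t ^+ 2 ->
  avg (gauss 1) s (avg (gauss 1) t phi) x = avg (gauss 1) r phi x.
Proof.
move=> tphi phi0 s0 r0 rst; have mg := moments_gauss (@ltr01 R).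
set g := normal_pdf (0 : R) 1.
have g0 y : 0 <= g y by exact: normal_pdf_ge0.
have mgf : measurable_fun [set: R] g by exact: measurable_normal_pdf.
have tav : temperate (avg (gauss 1) s phi) by exact: temperate_avg.
rewrite avg_comm//; apply: EFin_inj; rewrite !avg_gaussE//; last first.
  by move=> y; apply: Rintegral_ge0.
have mphi := temperate_measurable tphi.
have rs0 : r / s != 0 by rewrite mulf_neq0 ?invr_neq0// gt_eqF.
pose F z u : R := `|r / s| * (phi (x + r * u) * (g u * g (r / s * z + - (t * u / s)))).
have F0 z u : 0 <= F z u by rewrite /F !mulr_ge0.
(* After the substitution [y = (r * u - t * z) / s] the function [phi] depends on
   [u] alone, and [key] exchanges the roles of [u] and [z] in the density. *)
have key u z : g (r / s * u + - (t * z / s)) * g z = g u * g (r / s * z + - (t * u / s)).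
  rewrite /g normal_pdfE ?oner_neq0// mulrACA [RHS]mulrACA; congr (_ * _).
  rewrite /normal_fun -!expRD; congr expR; rewrite !subr0 expr1n.
  have -> (v w : R) : r / s * v + - (t * w / s) = (r * v - t * w) / s by field.
  suff : ((r * u - t * z) / s) ^+ 2 + z ^+ 2 = u ^+ 2 + ((r * z - t * u) / s) ^+ 2.
    by move=> E; transitivity (- (((r * u - t * z) / s) ^+ 2 + z ^+ 2) / (1 *+ 2)); [field|rewrite E; field].
  apply/eqP; rewrite -subr_eq0; apply/eqP.
  transitivity ((r ^+ 2 - (s ^+ 2 + t ^+ 2)) * (u ^+ 2 - z ^+ 2) / s ^+ 2); first by field.
  by rewrite rst subrr !mul0r.
transitivity (\int[leb]_z \int[leb]_u (F z u)%:E)%E.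
  apply: eq_integral => z _; rewrite EFinM avg_gaussE//.
  rewrite (@ge0_integral_affine _ (r / s) (- (t * z / s)))//; first last.
  - by move=> u; rewrite lee_fin mulr_ge0.
  - apply/measurable_EFinP; apply: measurable_funM => //.
    exact: (measurableT_comp mphi (measurable_line _ _)).
  pose h u := phi (x + t * z + s * (r / s * u + - (t * z / s))) *
    g (r / s * u + - (t * z / s)).
  have h0 u : (0 <= (h u)%:E)%E by rewrite lee_fin mulr_ge0.
  have mh : measurable_fun [set: R] (fun u => (h u)%:E).
    apply/measurable_EFinP; apply: measurable_funM.
      apply: (measurableT_comp mphi); apply: (measurable_funD) => //.
      by apply: measurable_funM => //; apply: measurable_funD => //; exact: measurable_funM.
    by apply: (measurableT_comp mgf); apply: measurable_funD => //; exact: measurable_funM.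
  transitivity ((`|r / s| * g z)%:E * \int[leb]_u (h u)%:E)%E.
    by rewrite EFinM muleAC.
  rewrite -(ge0_integralZl leb measurableT mh (fun u _ => h0 u)); last first.
    by rewrite lee_fin mulr_ge0.
  apply: eq_integral => u _; rewrite -EFinM; congr EFin; rewrite /F -key /h.
  have -> : x + t * z + s * (r / s * u + - (t * z / s)) = x + r * u by field.
  rewrite -/g; ring.
have mF : measurable_fun [set: R * R] (fun p => (F p.1 p.2)%:E).
  apply/measurable_EFinP; apply: measurable_funM => //; apply: measurable_funM.
    by apply: (measurableT_comp mphi); apply: measurable_funD => //; apply: measurable_funM.
  apply: measurable_funM; first exact: measurableT_comp.
  apply: (measurableT_comp mgf); apply: measurable_funD; first exact: measurable_funM.
  apply: measurableT_comp => //; apply: measurable_funM => //; exact: measurable_funM.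
transitivity (\int[leb]_u \int[leb]_z (F z u)%:E)%E.
  have F0' (p : R * R) : (0 <= (F p.1 p.2)%:E)%E by rewrite lee_fin.
  exact: (@fubini_tonelli _ _ (measurableTypeR R) (measurableTypeR R) R leb leb
    (fun p => (F p.1 p.2)%:E) mF F0').
apply: eq_integral => u _ /=.
transitivity ((phi (x + r * u) * g u)%:E * (`|r / s|%:E *
    \int[leb]_z (g (r / s * z + - (t * u / s)))%:E))%E.
  have mgz : measurable_fun [set: R] (fun z => (g (r / s * z + - (t * u / s)))%:E).
    apply/measurable_EFinP; apply: (measurableT_comp mgf).
    by apply: measurable_funD => //; exact: measurable_funM.
  rewrite -!ge0_integralZl//.
  - by apply: eq_integral => z _; rewrite -!EFinM; congr EFin; rewrite /F; ring.
  - by apply: emeasurable_funM.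
  - by move=> z _; rewrite mule_ge0// lee_fin.
  - by rewrite lee_fin mulr_ge0.
  - by move=> z _; rewrite lee_fin.
rewrite -(@ge0_integral_affine _ _ _ (EFin \o g))//; first last.
- by apply/measurable_EFinP.
by rewrite /= integral_normal_pdf mule1.
Qed.

End Gaussian.

(** * Absolute powers have rising curvature, up to sign *)
Section Powers.
Context {R : realType}.
Implicit Types (a b p r s x y : R).

Lemma powR_midpoint_convex r a b : 1 <= r -> 0 <= a -> 0 <= b ->
  2 * ((a + b) / 2) `^ r <= a `^ r + b `^ r.
Proof.
move=> r1 a0 b0; have h0 : (0 : R) <= 2^-1 by lra.
have h1 : (2^-1 : R) <= 1 by lra.
have := @convex_powR R r r1 (Itv01 h0 h1) a b.
rewrite !inE /= !in_itv/= !andbT a0 b0 => /(_ isT isT).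
have E : conv (Itv01 h0 h1) (a : R^o) b = (a + b) / 2.
  by rewrite convRE /= /unstable.onem; lra.
rewrite convRE /= /unstable.onem => le.
suff -> : (a + b) / 2 = conv (Itv01 h0 h1) (a : R^o) b by lra.
by rewrite E.
Qed.

Lemma powR_superadd r a b : 1 <= r -> 0 <= a -> 0 <= b ->
  a `^ r + b `^ r <= (a + b) `^ r.
Proof.
move=> r1 a0 b0; have r0 : 0 < r by rewrite (lt_le_trans ltr01).
have ab0 : 0 <= a + b by exact: addr_ge0.
rewrite -(mulr_powRB1 a0 r0) -(mulr_powRB1 b0 r0) -(mulr_powRB1 ab0 r0) mulrDl.
have r10 : 0 <= r - 1 by rewrite subr_ge0.
by apply: lerD; rewrite ler_wpM2l// ge0_ler_powR ?nnegrE// ?lerDl ?lerDr.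
Qed.

Lemma powR_subadd r a b : 0 <= r -> r <= 1 -> 0 <= a -> 0 <= b ->
  (a + b) `^ r <= a `^ r + b `^ r.
Proof.
move=> r0 r1 a0 b0; have [->|rn0] := eqVneq r 0; first by rewrite !powRr0; lra.
have ri1 : 1 <= r^-1 by rewrite invf_ge1// lt_neqAle eq_sym rn0.
have := powR_superadd ri1 (powR_ge0 a r) (powR_ge0 b r).
rewrite -!powRrM !mulfV// !powRr1// => le.
have := ge0_ler_powR r0 _ _ le.
rewrite -powRrM mulVf// powRr1 ?addr_ge0 ?powR_ge0//.
by apply; rewrite nnegrE ?addr_ge0 ?powR_ge0.
Qed.

Lemma continuous_norm_powR r : 0 <= r -> continuous (fun x : R => `|x| `^ r).
Proof.
rewrite le_eqVlt => /predU1P[<-|r0] x.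
  by under eq_fun do rewrite powRr0; exact: cvg_cst.
have [->|x0] := eqVneq x 0.
  have E : `|0 : R| `^ r = 0 by rewrite normr0 powR0// gt_eqF.
  rewrite /continuous_at E; apply/cvgr0Pnorm_lt => e e0.
  have N : \forall y \near (0 : R), `|y| < e `^ r^-1 by apply: nbhs0_lt; exact: powR_gt0.
  near=> y.
  rewrite ger0_norm ?powR_ge0// -[ltRHS]powRr1 ?ltW// -(mulVf (lt0r_neq0 r0)) powRrM.
  rewrite gt0_ltr_powR ?nnegrE ?powR_ge0//.
  by near: y.
have H : {for `|x|, continuous (fun y : R => y `^ r)}.
  apply/differentiable_continuous/derivable1_diffP/derivable_powR.
  by rewrite in_itv/= andbT normr_gt0.
apply: (cvg_comp (fun y : R => `|y|) (fun y => y `^ r)); last exact: H.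
by apply: cvg_norm; exact: cvg_id.
Unshelve. all: by end_near. Qed.

Lemma is_derive_norm_powR r x : x != 0 ->
  is_derive x 1 (fun y : R => `|y| `^ r) (Num.sg x * (r * `|x| `^ (r - 1))).
Proof.
rewrite neq_lt => /orP[x0|x0].
  rewrite ltr0_sg// ltr0_norm// mulN1r -mulrN1.
  apply: (@near_eq_is_derive _ _ _ ((fun y => y `^ r) \o -%R)).
    by near=> y; rewrite /= ltr0_norm//; near: y; exact: lt_nbhsl.
  apply: is_derive1_comp; apply: is_derive1_powR; by rewrite oppr_gt0.
rewrite gtr0_sg// gtr0_norm// mul1r.
apply: (@near_eq_is_derive _ _ _ (fun y => y `^ r)).
  by near=> y; rewrite gtr0_norm//; near: y; exact: lt_nbhsr.
exact: is_derive1_powR.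
Unshelve. all: by end_near. Qed.

Lemma powR_midpoint_concave r a b : 0 <= r -> r <= 1 -> 0 <= a -> 0 <= b ->
  a `^ r + b `^ r <= 2 * ((a + b) / 2) `^ r.
Proof.
move=> r0 r1 a0 b0; have [->|rn0] := eqVneq r 0; first by rewrite !powRr0; lra.
have ri1 : 1 <= r^-1 by rewrite invf_ge1// lt_neqAle eq_sym rn0.
have := powR_midpoint_convex ri1 (powR_ge0 a r) (powR_ge0 b r).
rewrite -!powRrM !mulfV// !powRr1// => le.
set m := (_ + _) / 2 in le; have m0 : 0 <= m by rewrite divr_ge0// addr_ge0// powR_ge0.
have le2 : m `^ r^-1 <= (a + b) / 2 by rewrite ler_pdivlMr// mulrC.
have n1 : m `^ r^-1 \is Num.nneg by rewrite nnegrE powR_ge0.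
have n2 : (a + b) / 2 \is Num.nneg by rewrite nnegrE divr_ge0// addr_ge0.
have := ge0_ler_powR r0 n1 n2 le2.
by rewrite -powRrM mulVf// powRr1// ler_pdivrMr// mulrC.
Qed.

(** The derivative in [x] of the second difference of [`|x| `^ (r + 1)] for
    [0 < x], up to a positive factor. *)
Let dsd r s x := (x + s) `^ r + Num.sg (x - s) * `|x - s| `^ r - 2 * x `^ r.

(** Convexity of [x `^ r] if [s <= x], superadditivity if [x <= s]. *)
Let dsd_ge0 r s x : 1 <= r -> 0 <= s -> 0 <= x -> 0 <= dsd r s x.
Proof.
move=> r1 s0 x0; rewrite /dsd subr_ge0.
have [xs|sx|->] := ltgtP x s.
- rewrite ltr0_sg ?subr_lt0// ltr0_norm ?subr_lt0// mulN1r opprB.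
  have sx0 : 0 <= s - x by rewrite subr_ge0 ltW.
  rewrite lerBrDr (le_trans _ (_ : (s - x + (x + x)) `^ r <= _))//; last first.
    by rewrite le_eqVlt; apply/orP; left; apply/eqP; congr (_ `^ _); ring.
  rewrite (le_trans _ (powR_superadd r1 sx0 (addr_ge0 x0 x0)))// addrC lerD2l.
  by rewrite (le_trans _ (powR_superadd r1 x0 x0))// mulr_natl mulr2n.
- rewrite gtr0_sg ?subr_gt0// gtr0_norm ?subr_gt0// mul1r.
  have sx0 : 0 <= x - s by rewrite subr_ge0 ltW.
  rewrite (le_trans _ (powR_midpoint_convex r1 (addr_ge0 x0 s0) sx0))//.
  by rewrite le_eqVlt; apply/orP; left; apply/eqP; congr (_ * _ `^ _); lra.
- rewrite subrr sgr0 mul0r addr0.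
  by rewrite (le_trans _ (powR_superadd r1 s0 s0))// mulr_natl mulr2n.
Qed.

(** Concavity of [x `^ r] if [s <= x], subadditivity if [x <= s]. *)
Let dsd_le0 r s x : 0 <= r -> r <= 1 -> 0 <= s -> 0 <= x -> dsd r s x <= 0.
Proof.
move=> r0 r1 s0 x0; rewrite /dsd subr_le0.
have [xs|sx|->] := ltgtP x s.
- rewrite ltr0_sg ?subr_lt0// ltr0_norm ?subr_lt0// mulN1r opprB.
  have sx0 : 0 <= s - x by rewrite subr_ge0 ltW.
  rewrite lerBlDr (le_trans (_ : _ <= (x + (x + (s - x))) `^ r))//.
    by rewrite le_eqVlt; apply/orP; left; apply/eqP; congr (_ `^ _); ring.
  rewrite (le_trans (powR_subadd r0 r1 x0 (addr_ge0 x0 sx0)))//.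
  by have := powR_subadd r0 r1 x0 sx0; lra.
- rewrite gtr0_sg ?subr_gt0// gtr0_norm ?subr_gt0// mul1r.
  have sx0 : 0 <= x - s by rewrite subr_ge0 ltW.
  rewrite (le_trans (powR_midpoint_concave r0 r1 (addr_ge0 x0 s0) sx0))//.
  by rewrite le_eqVlt; apply/orP; left; apply/eqP; congr (_ * _ `^ _); lra.
- rewrite subrr sgr0 mul0r addr0.
  by rewrite (le_trans (powR_subadd r0 r1 s0 s0))// mulr_natl mulr2n.
Qed.

Lemma temperate_norm_powR p : 1 <= p -> temperate (fun x : R => `|x| `^ p).
Proof.
move=> p1; have p0 : 0 <= p by rewrite (le_trans ler01).
have [m pm] : exists m : nat, p <= m%:R.
  by exists (Num.bound p); rewrite ltW// archi_boundP.
exists p, m; split=> //.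
have wlog (x y : R) : `|x| <= `|y| ->
    `| `|x| `^ p - `|y| `^ p | <= p * `|x - y| * (weight m x * weight m y).
  move=> xy; have [E|nE] := eqVneq `|x| `|y|.
    by rewrite E subrr normr0 !mulr_ge0 ?weight_ge0.
  have {nE}xy : `|x| < `|y| by rewrite lt_neqAle nE.
  have [||c] := @MVT R (fun t => `|t| `^ p) (fun t => Num.sg t * (p * `|t| `^ (p - 1))) _ _ xy.
  - move=> t; rewrite in_itv/= => /andP[xt _]; apply: is_derive_norm_powR.
    by rewrite gt_eqF// (le_lt_trans _ xt).
  - by apply: continuous_subspaceT; exact: continuous_norm_powR.
  rewrite in_itv/= => /andP[xc cy]; rewrite !normr_id distrC => ->.
  have c0 : 0 < c by rewrite (le_lt_trans _ xc).
  rewrite gtr0_sg// mul1r (gtr0_norm c0) !normrM (ger0_norm p0).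
  rewrite (ger0_norm (powR_ge0 _ _)) -!mulrA ler_wpM2l// mulrC ler_pM ?normr_ge0 ?powR_ge0//.
    by rewrite distrC ler_dist_dist.
  rewrite -[leLHS]mul1r ler_pM ?powR_ge0 ?weight_ge1//.
  apply: (@le_trans _ _ ((1 + y ^+ 2) `^ (p - 1))).
    rewrite ge0_ler_powR ?nnegrE ?subr_ge0 ?(ltW c0) ?addr_ge0 ?sqr_ge0//.
    by rewrite (le_trans (ltW cy))// -(real_normK (num_real y)); nra.
  have y1 : 1 <= 1 + y ^+ 2 by rewrite lerDl sqr_ge0.
  rewrite /weight -(powR_mulrn m (le_trans ler01 y1)) ler_powR//.
  by rewrite (le_trans _ pm)// gerBl.
move=> x y; have [|/ltW] := leP `|x| `|y|; first exact: wlog.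
by move=> /wlog; rewrite distrC (distrC y x) (mulrC (weight m y)).
Qed.

(** The second difference of step [s] is differentiable at every [0 < x] other
    than [s], so it is monotone on both sides of [s] and then throughout. *)
Let rising_curvature_scaled (c p : R) : 1 <= p ->
  (forall s x, 0 <= s -> 0 < x -> 0 <= c * dsd (p - 1) s x) ->
  rising_curvature (fun x : R => c * `|x| `^ p).
Proof.
move=> p1 dsdc; have p0 : 0 <= p by rewrite (le_trans ler01).
split.
- exact: temperateZ (temperate_norm_powR p1).
- by move=> x; rewrite normrN.
set phi := fun x : R => c * `|x| `^ p.
have phiN x : phi (- x) = phi x by rewrite /phi normrN.
have sdN s x : sdiff phi (- s) x = sdiff phi s x by rewrite /sdiff opprK; ring.
have sdx s x : sdiff phi s (- x) = sdiff phi s x.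
  rewrite /sdiff phiN -[phi (- x + s)]phiN -[phi (- x - s)]phiN !opprD !opprK; ring.
have cphi : continuous phi.
  by move=> x; apply: cvgM; [exact: cvg_cst|exact: continuous_norm_powR].
have step s x y : 0 <= s -> 0 <= x -> x <= y -> (y <= s \/ s <= x) ->
    sdiff phi s x <= sdiff phi s y.
  move=> s0 x0; rewrite le_eqVlt => /predU1P[->//|xy] side.
  rewrite -subr_ge0.
  have [||t] := @MVT R (sdiff phi s) (fun t => p * (c * dsd (p - 1) s t)) _ _ xy.
  - move=> t; rewrite in_itv/= => /andP[xt ty].
    have t0 : 0 < t by rewrite (le_lt_trans x0).
    have ts0 : 0 < t + s by rewrite ltr_wpDr.
    have tns : t - s != 0.
      by rewrite subr_eq0; case: side => h; [rewrite lt_eqF// (lt_le_trans ty)|rewrite gt_eqF// (le_lt_trans h)].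
    have d1 : is_derive t 1 (fun t => `|t + s| `^ p) (p * (t + s) `^ (p - 1) * 1).
      apply: (@is_derive1_comp R (fun t => `|t| `^ p) (fun t => t + s)).
        have := is_derive_norm_powR p (lt0r_neq0 ts0).
        by rewrite gtr0_sg// mul1r gtr0_norm.
      by apply: is_derive_eq; rewrite addr0.
    have d2 : is_derive t 1 (fun t => `|t - s| `^ p)
        (Num.sg (t - s) * (p * `|t - s| `^ (p - 1)) * 1).
      apply: (@is_derive1_comp R (fun t => `|t| `^ p) (fun t => t - s)).
        exact: is_derive_norm_powR.
      by apply: is_derive_eq; rewrite subr0.
    have d3 : is_derive t 1 (fun t => `|t| `^ p) (p * t `^ (p - 1)).
      by have := is_derive_norm_powR p (lt0r_neq0 t0); rewrite gtr0_sg// mul1r gtr0_norm.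
    rewrite /sdiff /phi; apply: is_derive_eq.
    by rewrite /dsd /GRing.scale/=; ring.
  - apply: continuous_subspaceT => t; apply: cvgB; first apply: cvgD.
    + apply: (cvg_comp (fun t => t + s) phi); last exact: cphi.
      by apply: cvgD; [exact: cvg_id|exact: cvg_cst].
    + apply: (cvg_comp (fun t => t - s) phi); last exact: cphi.
      by apply: cvgB; [exact: cvg_id|exact: cvg_cst].
    + by apply: cvgM; [exact: cvg_cst|exact: cphi].
  rewrite in_itv/= => /andP[xt ty] ->.
  apply: mulr_ge0; last by rewrite subr_ge0 ltW.
  by apply: mulr_ge0 => //; apply: dsdc => //; rewrite (le_lt_trans x0).
have mono s x y : 0 <= s -> 0 <= x -> x <= y -> sdiff phi s x <= sdiff phi s y.
  move=> s0 x0 xy; have [ys|sy] := leP y s; first by apply: step => //; left.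
  have [sx|xs] := leP s x; first by apply: step => //; right.
  apply: (@le_trans _ _ (sdiff phi s s)).
    by apply: step => //; [exact: ltW|left].
  by apply: step => //; [exact: ltW|right].
move=> s x y xy.
have sabs z : sdiff phi s z = sdiff phi `|s| `|z|.
  by case: (ger0P s) => _; case: (ger0P z) => _; rewrite ?sdN ?sdx.
by rewrite !sabs mono.
Qed.

Lemma rising_curvature_powR p : 2 <= p -> rising_curvature (fun x : R => `|x| `^ p).
Proof.
move=> p2; under eq_fun do rewrite -[_ `^ _]mul1r.
apply: rising_curvature_scaled; first by rewrite (le_trans _ p2)// ler1n.
by move=> s x s0 x0; rewrite mul1r dsd_ge0 ?(ltW x0)//; lra.
Qed.

Lemma rising_curvature_powRN p : 1 <= p <= 2 ->
  rising_curvature (fun x : R => - `|x| `^ p).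
Proof.
move=> /andP[p1 p2]; under eq_fun do rewrite -mulN1r.
apply: rising_curvature_scaled => // s x s0 x0.
by rewrite mulN1r oppr_ge0 dsd_le0 ?(ltW x0)//; lra.
Qed.

End Powers.

(** * Absolute moments of the Gaussian law *)
Section GaussianMoments.
Context {R : realType}.
Implicit Types (phi h : R -> R).
Local Notation leb := (@lebesgue_measure R).
Local Notation g := (normal_pdf (0 : R) 1).

Lemma gauss_semigroup (s t r x : R) phi : temperate phi -> 0 <= r ->
  r ^+ 2 = s ^+ 2 + t ^+ 2 ->
  avg (gauss 1) s (avg (gauss 1) t phi) x = avg (gauss 1) r phi x.
Proof.
move=> tphi r0 rst; have mg := moments_gauss (@ltr01 R).
have [s0|s0] := eqVneq s 0.
  have -> : r = `|t|.
    by apply: (@pexpIrn _ 2); rewrite ?nnegrE// rst s0 expr0n add0r real_normK ?num_real.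
  rewrite s0 avgE0; case: (ger0P t) => // _.
  by rewrite (bell_avgN _ _ (bell_gauss ltr01)).
have {}r0 : 0 < r.
  rewrite lt_neqAle r0 andbT eq_sym -sqrf_eq0 rst.
  by rewrite gt_eqF// ltr_pwDl ?sqr_ge0// exprn_even_gt0.
(* Both terms of [phi = (phi + `|phi|) - `|phi|] are nonnegative. *)
have tabs := temperate_norm tphi.
have tp : temperate (fun y => phi y + `|phi y|) by exact: temperateD.
have split1 (a : R) y : avg (gauss 1) a phi y =
    avg (gauss 1) a (fun z => phi z + `|phi z|) y - avg (gauss 1) a (fun z => `|phi z|) y.
  by rewrite -avgB//; apply: eq_Rintegral => z _; rewrite addrK.
rewrite (_ : avg (gauss 1) t phi = fun y => avg (gauss 1) t (fun z => phi z + `|phi z|) y -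
    avg (gauss 1) t (fun z => `|phi z|) y); last exact/funext/split1.
rewrite avgB//; [|exact: temperate_avg..].
rewrite split1 !(gauss_semigroup_ge0 _ _ _ s0 r0 rst)// => y.
by have := ler_norm (- phi y); rewrite normrN; lra.
Qed.

Lemma normal_pdf01E x : g x = normal_peak 1 * expR (- (x ^+ 2 / 2)).
Proof.
rewrite normal_pdfE ?oner_neq0//; congr (_ * expR _); rewrite subr0 expr1n.
by rewrite mulNr.
Qed.

Lemma is_derive_normal_pdf01 (x : R) : is_derive x 1 g (- x * g x).
Proof.
rewrite (_ : g = fun y => normal_peak 1 * expR (- (y ^+ 2 / 2))); last first.
  by apply/funext => y; exact: normal_pdf01E.
have d : is_derive x 1 (fun y : R => - (y ^+ 2 / 2)) (- x).
  by apply: is_derive_eq; rewrite /GRing.scale/=; lra.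
apply: is_derive_eq; rewrite /GRing.scale/=; ring.
Qed.

Lemma normal_peak1 : normal_peak (1 : R) = (Num.sqrt (2 * pi))^-1.
Proof. by rewrite /normal_peak expr1n mul1r mulr_natl. Qed.

Lemma integral_gauss_even h : continuous h -> (forall x, 0 <= h x) ->
  (forall x, h (- x) = h x) ->
  (\int[gauss 1]_x (h x)%:E = 2%:E * \int[leb]_(x in `[0%R, +oo[) (h x * g x)%:E)%E.
Proof.
move=> ch h0 hN; have [mf f0 muf _] := bell_gauss (@ltr01 R).
rewrite (ge0_integral_density mf f0 muf)//; last first.
  by apply/measurable_EFinP; exact: continuous_measurable_fun.
under eq_integral do rewrite -EFinM.
rewrite (@ge0_symfun_integralT _ (fun x => h x * g x)).
- congr (_ * _)%E; congr (integral _ _ _).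
  by apply/seteqP; split=> x /=; rewrite in_itv/= andbT.
- by move=> x; rewrite mulr_ge0.
- by move=> x; apply: cvgM; [exact: ch|apply: continuous_normal_pdf; exact: oner_neq0].
- by move=> x /=; rewrite hN !normal_pdf01E sqrrN.
Qed.

Lemma half_gauss : (\int[leb]_(x in `[0%R, +oo[) (g x)%:E = (2^-1)%:E)%E.
Proof.
have c1 : continuous (fun _ : R => 1 : R) by move=> x; exact: cvg_cst.
have := @integral_gauss_even (fun=> 1) c1 (fun=> ler01) (fun=> erefl).
rewrite (_ : \int[gauss 1]_x 1%:E = 1)%E; last first.
  by rewrite integral_cst// mul1e; exact: probability_setT.
have -> : (\int[leb]_(x in `[0%R, +oo[) (1 * g x)%:E =
    \int[leb]_(x in `[0%R, +oo[) (g x)%:E)%E.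
  by apply: eq_integral => x _; rewrite mul1r.
case: (\int[leb]_(x in _) _)%E => [r| |] /=.
- by rewrite -EFinM => E; have {}E := EFin_inj E; congr EFin; lra.
- by rewrite gt0_muley ?lte_fin.
- by rewrite gt0_muleNy ?lte_fin.
Qed.

(** Integrate by parts on [[0, n]]: the derivative of [x * g x] is
    [g x - x ^+ 2 * g x], and the boundary term vanishes in the limit. *)
Lemma gauss_second_moment : \int[gauss 1]_x (x ^+ 2) = 1 :> R.
Proof.
have csq : continuous (fun x : R => x ^+ 2) by exact: exprn_continuous.
have cg : continuous (g : R -> R) by apply: continuous_normal_pdf; exact: oner_neq0.
rewrite /Rintegral (integral_gauss_even csq)//; last 2 first.
- by move=> x; exact: sqr_ge0.
- by move=> x; exact: sqrrN.
suff -> : (\int[leb]_(x in `[0%R, +oo[) (x ^+ 2 * g x)%:E = (2^-1)%:E)%E.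
  by rewrite -EFinM /=; lra.
have mg : measurable_fun [set: R] (g : R -> R) by exact: measurable_normal_pdf.
have g0 (x : R) : 0 <= g x by exact: normal_pdf_ge0.
have msg : measurable_fun [set: R] (fun x : R => x ^+ 2 * g x).
  by apply: measurable_funM => //; exact: continuous_measurable_fun.
have sg0 (x : R) : 0 <= x ^+ 2 * g x by rewrite mulr_ge0 ?sqr_ge0.
have c1 := @ge0_cvgn_integral R leb _ sg0 msg.
have c2 := @ge0_cvgn_integral R leb _ g0 mg.
rewrite half_gauss in c2.
suff : (\int[leb]_(x in `[0%R, n%:R]) (x ^+ 2 * g x)%:E)%E @[n --> \oo] --> (2^-1)%:E.
  by move=> c3; exact: (cvg_unique _ c1 c3).
have FTC n : (\int[leb]_(x in `[0%R, n.+1%:R]) (x ^+ 2 * g x)%:E =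
    \int[leb]_(x in `[0%R, n.+1%:R]) (g x)%:E - (n.+1%:R * g n.+1%:R)%:E)%E.
  have cxg : continuous (fun x : R => x * g x).
    by move=> x; apply: cvgM; [exact: cvg_id|exact: cg].
  have cf : continuous (fun x : R => g x - x ^+ 2 * g x).
    move=> x; apply: cvgB; first exact: cg.
    by apply: cvgM; [exact: csq|exact: cg].
  have dxg (x : R) : is_derive x 1 (fun x : R => x * g x) (g x - x ^+ 2 * g x).
    have dg := is_derive_normal_pdf01 x.
    by apply: is_derive_eq; rewrite /GRing.scale/=; ring.
  have := @continuous_FTC2 R (fun x => g x - x ^+ 2 * g x) (fun x => x * g x) 0 n.+1%:R.
  rewrite ltr0Sn mul0r sube0 => <-//.
  - have ib (h : R -> R) : continuous h -> leb.-integrable `[0%R, n.+1%:R] (EFin \o h).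
      move=> ch; apply: continuous_compact_integrable; first exact: segment_compact.
      exact: continuous_subspaceT.
    have i1 := ib _ cg.
    have cxxg : continuous (fun x : R => x ^+ 2 * g x).
      by move=> x; apply: cvgM; [exact: csq|exact: cg].
    have i2 := ib _ cxxg.
    rewrite integralB_EFin//.
    have /fineK <- : (\int[leb]_(x in `[0%R, n.+1%:R]) (g x)%:E)%E \is a fin_num.
      by apply: integrable_fin_num i1.
    have /fineK <- : (\int[leb]_(x in `[0%R, n.+1%:R]) (x ^+ 2 * g x)%:E)%E \is a fin_num.
      by apply: integrable_fin_num i2.
    by rewrite -!EFinB; congr EFin; ring.
  - exact: continuous_subspaceT.
  - split.
    + by move=> x _; have [] := dxg x.
    + by apply: cvg_at_right_filter; exact: cxg.
    + by apply: cvg_at_left_filter; exact: cxg.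
  - by move=> x _; rewrite derive1E; have [_ ->] := dxg x.
have cng : (n.+1%:R * g n.+1%:R) @[n --> \oo] --> (0 : R).
  apply: (@squeeze_cvgr _ _ _ _ (fun=> 0) (fun n => 2 * normal_peak 1 * n.+1%:R^-1)).
  - apply: nearW => n; rewrite mulr_ge0//=.
    have n0 : (0 : R) < n.+1%:R by [].
    rewrite ler_pdivlMr// normal_pdf01E expRN.
    set u := n.+1%:R ^+ 2 / 2; have := expR_ge1Dx u.
    have nE : n.+1%:R ^+ 2 = 2 * u by rewrite /u; field.
    rewrite (_ : _ * _ * _ = normal_peak 1 * n.+1%:R ^+ 2 / expR u); last by ring.
    rewrite ler_pdivrMr ?expR_gt0// nE => eu.
    by have := normal_peak_ge0 (1 : R); nra.
  - exact: cvg_cst.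
  - rewrite -[in X in _ --> X](mulr0 (2 * normal_peak (1 : R))).
    by apply: cvgM; [exact: cvg_cst|exact: cvg_harmonic].
have c3 : (\int[leb]_(x in `[0%R, n.+1%:R]) (g x)%:E - (n.+1%:R * g n.+1%:R)%:E)%E
    @[n --> \oo] --> ((2^-1)%:E - 0%:E)%E.
  apply: cvgeB => //; last by apply: cvg_EFin; [apply: nearW|exact: cng].
  by rewrite (cvg_shiftS (fun n => \int[leb]_(x in `[0%R, n%:R]) (g x)%:E)%E).
rewrite sube0 in c3; rewrite -cvg_shiftS/=.
by under eq_fun do rewrite FTC.
Qed.

Lemma gauss_variance s : 0 < s -> \int[gauss s]_x (x ^+ 2) = s ^+ 2 :> R.
Proof.
move=> s0; rewrite integral_gauss_scale//; last exact: temperate_sqr.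
under eq_Rintegral do rewrite exprMn.
rewrite RintegralZl ?gauss_second_moment ?mulr1//.
exact: temperate_integrable (moments_gauss ltr01) temperate_sqr.
Qed.

End GaussianMoments.

Section GaussianAbsMoment.
Context {R : realType}.
Local Notation leb := (@lebesgue_measure R).
Local Notation g := (normal_pdf (0 : R) 1).

(** The substitution [t = x ^+ 2 / 2], made on [[0, n]] before [n] tends to
    infinity. *)
Lemma integral_half_sqr (G : R -> R) : continuous G -> (forall x, 0 <= G x) ->
  (\int[leb]_(x in `[0%R, +oo[) (G (x ^+ 2 / 2) * `|x|)%:E =
   \int[leb]_(t in `[0%R, +oo[) (G t)%:E)%E.
Proof.
move=> cG G0; pose F (x : R) := x ^+ 2 / 2.
have cF : continuous F.
  by move=> x; apply: cvgM; [exact: exprn_continuous|exact: cvg_cst].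
have dF (x : R) : is_derive x 1 F x.
  by apply: is_derive_eq; rewrite /GRing.scale/=; lra.
have F'E : F^`()%classic = id.
  by apply/funext => x; rewrite derive1E; have [_ ->] := dF x.
pose k x := G (x ^+ 2 / 2) * `|x|.
have ck : continuous k.
  move=> x; apply: cvgM; last by apply: cvg_norm; exact: cvg_id.
  by apply: (cvg_comp F G); [exact: cF|exact: cG].
have k0 x : 0 <= k x by rewrite mulr_ge0.
have c1 := @ge0_cvgn_integral R leb _ k0 (continuous_measurable_fun ck).
have c2 : (\int[leb]_(t in `[0%R, F n%:R]) (G t)%:E)%E @[n --> \oo] -->
    (\int[leb]_(t in `[0%R, +oo[) (G t)%:E)%E.
  rewrite (_ : `[0%R, +oo[%classic = \bigcup_(n : nat) `[0%R, F n%:R]%classic).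
    apply: ge0_nondecreasing_set_cvg_integral => //.
    - apply/nondecreasing_seqP => n; apply/subsetPset => x /=; rewrite !in_itv/= => /andP[-> xn].
      rewrite (le_trans xn)// /F ler_pM2r ?invr_gt0// ler_sqr ?nnegrE//.
      by rewrite ler_nat.
    - by move=> i; apply: measurable_funTS; apply/measurable_EFinP; exact: continuous_measurable_fun.
    - by move=> i x _; rewrite lee_fin.
  apply/seteqP; split=> [x|x [n _]] /=; last by rewrite !in_itv/= => /andP[->].
  rewrite in_itv/= andbT => x0.
  pose n := Num.bound (2 * x); exists n => //=; rewrite in_itv/= x0/= /F.
  have xn : 2 * x < n%:R by apply: archi_boundP; rewrite mulr_ge0.
  have [n0|n1] : n = 0%N \/ (1 <= n%:R :> R).
    by case: (n) => [|m]; [left|right; rewrite ler1n].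
    by move: xn; rewrite n0; lra.
  by nra.
apply: (cvg_unique _ c1); rewrite //.
suff -> : (fun n => \int[leb]_(x in `[0%R, n%:R]) (k x)%:E)%E =
  (fun n => \int[leb]_(t in `[0%R, F n%:R]) (G t)%:E)%E by [].
apply/funext => n; rewrite -{2}(_ : F 0 = 0); last by rewrite /F expr0n mul0r.
rewrite (@integration_by_substitution_increasing R F G 0 n%:R)//.
- by apply: eq_integral => x; rewrite inE/= in_itv/= => /andP[x0 _]; rewrite /k F'E/= ger0_norm.
- move=> x y; rewrite !in_itv/= => /andP[x0 _] /andP[y0 _] xy.
  by rewrite /F ltr_pM2r ?invr_gt0// ltr_sqr ?nnegrE.
- by rewrite F'E => x _; exact: cvg_id.
- by rewrite F'E; apply/cvg_ex; exists 0; apply: cvg_at_right_filter; exact: cvg_id.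
- by rewrite F'E; apply/cvg_ex; exists n%:R; apply: cvg_at_left_filter; exact: cvg_id.
- split.
  + by move=> x _; have [] := dF x.
  + by apply: cvg_at_right_filter; exact: cF.
  + by apply: cvg_at_left_filter; exact: cF.
- exact: continuous_subspaceT.
Qed.

Lemma abs_moment_integrandE (p x : R) : 0 < p -> 0 <= x ->
  `|x| `^ p * g x = normal_peak (1 : R) * 2 `^ ((p + 1) / 2 - 1) *
    (`|x ^+ 2 / 2| `^ ((p + 1) / 2 - 1) * expR (- (x ^+ 2 / 2)) * `|x|).
Proof.
move=> p0 x0; set r := (p + 1) / 2 - 1.
have x20 : 0 <= x ^+ 2 / 2 by rewrite divr_ge0// sqr_ge0.
rewrite normal_pdf01E (ger0_norm x20) (ger0_norm x0).
have -> : x `^ p = 2 `^ r * (x ^+ 2 / 2) `^ r * x.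
  rewrite -powRM// (_ : 2 * (x ^+ 2 / 2) = x ^+ 2); last by field.
  rewrite -(powR_mulrn 2 x0) -powRrM mulrC -(mulr_powRB1 x0 p0); congr (_ * _ `^ _).
  by rewrite /r; lra.
by ring.
Qed.

Lemma gauss_const_powR (p : R) : 0 < p -> 0 <= Gamma ((p + 1) / 2) ->
  gauss_const p `^ p =
  2 * (normal_peak (1 : R) * 2 `^ ((p + 1) / 2 - 1)) * Gamma ((p + 1) / 2).
Proof.
move=> p0; rewrite /gauss_const; set r := (p + 1) / 2 - 1; set Gam := Gamma _ => Gam0.
rewrite (powRM _ (sqrtr_ge0 _) (powR_ge0 _ _)) -powRrM mulVf ?gt_eqF//.
rewrite powRr1; last by rewrite divr_ge0// sqrtr_ge0.
rewrite normal_peak1 sqrtrM// invfM -powR12_sqrt// -powRrM.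
have -> : 2^-1 * p = r + 2^-1 :> R by rewrite /r; lra.
rewrite powRD; last by rewrite pnatr_eq0 implybT.
have s2 : (2 : R) `^ 2^-1 * 2 `^ 2^-1 = 2.
  by rewrite powR12_sqrt// -expr2 sqr_sqrtr.
have s20 : (2 : R) `^ 2^-1 != 0 by rewrite gt_eqF// powR_gt0.
have -> : 2 * ((2 `^ 2^-1)^-1 / Num.sqrt pi * 2 `^ r) * Gam =
  (2 `^ 2^-1 * 2 `^ 2^-1) * ((2 `^ 2^-1)^-1 / Num.sqrt pi * 2 `^ r) * Gam :> R by rewrite s2.
by field; rewrite s20 gt_eqF// sqrtr_gt0 pi_gt0.
Qed.

(** Under the substitution of [integral_half_sqr] the moment becomes Euler's integral at
    [(p + 1) / 2]. *)
Lemma gauss_abs_moment (p : R) : 1 <= p ->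
  \int[gauss 1]_x (`|x| `^ p) = gauss_const p `^ p.
Proof.
move=> p1; have p0 : 0 < p by rewrite (lt_le_trans ltr01).
have tp := temperate_norm_powR p1.
have cp := temperate_continuous tp.
pose r := (p + 1) / 2 - 1.
have r0 : 0 <= r by rewrite /r; lra.
pose G (t : R) := `|t| `^ r * expR (- t).
have cG : continuous G.
  move=> t; apply: cvgM; first exact: continuous_norm_powR.
  by apply: (cvg_comp (fun t : R => - t) expR); [apply: cvgN; exact: cvg_id|exact: continuous_expR].
have G0 x : 0 <= G x by rewrite mulr_ge0 ?powR_ge0 ?expR_ge0.
set I := (\int[leb]_(t in `[0%R, +oo[) (G t)%:E)%E.
have GammaE : Gamma ((p + 1) / 2) = fine I.
  rewrite /Gamma /Rintegral /I -integral_itv_obnd_cbnd; last first.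
    by apply: measurable_funTS; apply/measurable_EFinP; exact: continuous_measurable_fun.
  congr fine; apply: eq_integral => x; rewrite inE/= in_itv/= andbT => x0.
  by rewrite /G gtr0_norm.
pose C := normal_peak (1 : R) * 2 `^ r.
have ck : continuous (fun x : R => G (x ^+ 2 / 2) * `|x|).
  move=> x; apply: cvgM; last by apply: cvg_norm; exact: cvg_id.
  apply: (cvg_comp (fun x : R => x ^+ 2 / 2) G); last exact: cG.
  by apply: cvgM; [exact: exprn_continuous|exact: cvg_cst].
have C0 : 0 < C by rewrite mulr_gt0 ?normal_peak_gt0 ?oner_neq0 ?powR_gt0.
have E : (\int[gauss 1]_x (`|x| `^ p)%:E = 2%:E * (C%:E * I))%E.
  rewrite (integral_gauss_even cp); last 2 first.
  - by move=> x; exact: powR_ge0.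
  - by move=> x; rewrite normrN.
  have mk : measurable_fun [set: R] (fun x : R => (G (x ^+ 2 / 2) * `|x|)%:E).
    by apply/measurable_EFinP; exact: continuous_measurable_fun.
  have <- : (\int[leb]_(x in `[0%R, +oo[) (G (x ^+ 2 / 2) * `|x|)%:E = I)%E.
    exact: integral_half_sqr.
  have k0 (x : R) : (0 <= (G (x ^+ 2 / 2) * `|x|)%:E)%E by rewrite lee_fin mulr_ge0.
  have C0' : (0 <= C%:E)%E by rewrite lee_fin ltW.
  have <- : (\int[leb]_(x in `[0%R, +oo[) (C%:E * (G (x ^+ 2 / 2) * `|x|)%:E) =
      C%:E * \int[leb]_(x in `[0%R, +oo[) (G (x ^+ 2 / 2) * `|x|)%:E)%E.
    by apply: ge0_integralZl => //; exact: measurable_funTS mk.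
  congr (_ * _)%E.
  apply: eq_integral => x; rewrite inE/= in_itv/= andbT => x0.
  by rewrite -EFinM abs_moment_integrandE.
have ip := temperate_integrable (moments_gauss (@ltr01 R)) tp.
have fI : I \is a fin_num.
  have : (\int[gauss 1]_x (`|x| `^ p)%:E)%E \is a fin_num by apply: integrable_fin_num ip.
  rewrite E; have : (0 <= I)%E by apply: integral_ge0 => x _; rewrite lee_fin.
  by case: I E {GammaE} => [s| |] E //=; rewrite !gt0_muley ?lte_fin.
rewrite /Rintegral E -(fineK fI) -!EFinM /= -GammaE.
have Gam0 : 0 <= Gamma ((p + 1) / 2).
  by rewrite GammaE fine_ge0//; apply: integral_ge0 => x _; rewrite lee_fin.
by rewrite gauss_const_powR// /C mulrA.
Qed.

Lemma gauss_const_ge0 (p : R) : 0 <= gauss_const p.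
Proof. by rewrite mulr_ge0 ?sqrtr_ge0 ?powR_ge0. Qed.

End GaussianAbsMoment.

(** * Comparison of the given laws with the Gaussian law *)
Section ExpPowerLaw.
Context {R : realType}.
Implicit Types (mu : probability R R).
Local Notation leb := (@lebesgue_measure R).

Lemma sqr_sub1_le_powR (r x : R) : 2 <= r -> 0 <= x -> x ^+ 2 - 1 <= x `^ r.
Proof.
move=> r2 x0; have [x1|x1] := leP x 1.
  by apply: (le_trans _ (powR_ge0 x r)); rewrite subr_le0 expr_le1.
rewrite -(powR_mulrn 2 x0) lerBlDr (le_trans (_ : _ <= x `^ r))//.
  by rewrite ler_powR// ltW.
by rewrite lerDl.
Qed.

Lemma powR_sqr_convex (r x y z : R) : 2 <= r -> 0 <= x -> x < y -> y < z ->
  y `^ r * (z ^+ 2 - x ^+ 2) <=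
  x `^ r * (z ^+ 2 - y ^+ 2) + z `^ r * (y ^+ 2 - x ^+ 2).
Proof.
move=> r2 x0 xy yz; have := rising_curvature_convex_sqr (rising_curvature_powR r2) x0 xy yz.
have y0 := le_trans x0 (ltW xy).
by rewrite !ger0_norm// (le_trans y0)// ltW.
Qed.

(** Up to a constant, the logarithm [b * x ^+ 2 - `|x| `^ q] of the ratio of the
    two densities is concave in [x ^+ 2] because [2 <= q]; its superlevel sets
    are intervals. *)
Lemma exp_power_bell mu (q c : R) : 2 <= q -> 0 < c ->
  (forall A, measurable A ->
    mu A = \int[leb]_(x in A) (c * expR (- (`|x| `^ q)))%:E)%E ->
  [/\ bell_density mu (fun x => c * expR (- (`|x| `^ q))), moments mu &
    forall s x y z, 0 < s -> 0 <= x -> x < y -> y < z ->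
      normal_pdf 0 s x < c * expR (- (`|x| `^ q)) ->
      normal_pdf 0 s z < c * expR (- (`|z| `^ q)) ->
      normal_pdf 0 s y < c * expR (- (`|y| `^ q))].
Proof.
move=> q2 c0 muE; have q0 : 0 <= q by rewrite (le_trans _ q2).
have bf : bell_density mu (fun x => c * expR (- (`|x| `^ q))).
  split; [|move=> {muE}x|exact: muE|move=> {muE}x y xy].
  - apply: continuous_measurable_fun => x; apply: cvgM; first exact: cvg_cst.
    apply: (cvg_comp (fun x : R => - (`|x| `^ q)) expR); last exact: continuous_expR.
    by apply: cvgN; exact: continuous_norm_powR.
  - by rewrite mulr_ge0 ?expR_ge0// ltW.
  - rewrite ler_pM2l// ler_expR lerN2.
    by rewrite ge0_ler_powR ?nnegrE.
move=> {muE}; split; first exact: bf.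
  apply: (moments_of_density (C := c * expR 1) (b := 1) bf ltr01) => {bf}x.
  rewrite -mulrA ler_pM2l// -expRD ler_expR mul1r.
  by have := sqr_sub1_le_powR q2 (normr_ge0 x); rewrite real_normK ?num_real//; lra.
move=> s x y z {bf} s0 x0 xy yz.
have y0 := le_trans x0 (ltW xy); have z0 := le_trans y0 (ltW yz).
set b := (s ^+ 2 *+ 2)^-1; set k := normal_peak s.
pose e (t : R) := b * t ^+ 2 - t `^ q.
have E t : 0 <= t -> (normal_pdf 0 s t < c * expR (- (`|t| `^ q))) = (k < c * expR (e t)).
  move=> t0; rewrite normal_pdfE ?gt_eqF// /normal_fun subr0 (ger0_norm t0).
  rewrite -/b -/k -(ltr_pM2r (expR_gt0 (t ^+ 2 * b))) -[k * _ * _]mulrA -[c * _ * _]mulrA -!expRD.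
  have -> : - t ^+ 2 * b + t ^+ 2 * b = 0 by ring.
  have -> : - t `^ q + t ^+ 2 * b = e t by rewrite /e; ring.
  by rewrite expR0 mulr1.
rewrite (E x x0) (E y y0) (E z z0) => ex ez.
have xz : 0 < z ^+ 2 - x ^+ 2 by nra.
have := powR_sqr_convex q2 x0 xy yz => cvx.
have [h|h] : e x <= e y \/ e z <= e y.
  have [h|h] := leP (e x) (e y); first by left.
  right; rewrite leNgt; apply/negP => h2; move: h h2 cvx.
  set X := x `^ q; set Y := y `^ q; set Z := z `^ q; rewrite /e -/X -/Y -/Z => h h2 cvx.
  have yx2 : 0 < y ^+ 2 - x ^+ 2 by nra.
  have zy2 : 0 < z ^+ 2 - y ^+ 2 by nra.
  nra.
- by apply: (lt_le_trans ex); rewrite ler_pM2l// ler_expR.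
- by apply: (lt_le_trans ez); rewrite ler_pM2l// ler_expR.
Qed.

(** The uniform density exceeds the Gaussian one only on its support, where it
    is constant while the Gaussian density decreases with [`|x|]. *)
Lemma uniform_bell mu : (forall A, measurable A ->
    mu A = \int[leb]_(x in A) (uniform_pdf (-1 : R) 1 x)%:E)%E ->
  [/\ bell_density mu (uniform_pdf (-1 : R) 1), moments mu &
    forall s x y z, 0 < s -> 0 <= x -> x < y -> y < z ->
      normal_pdf 0 s x < uniform_pdf (-1 : R) 1 x ->
      normal_pdf 0 s z < uniform_pdf (-1 : R) 1 z ->
      normal_pdf 0 s y < uniform_pdf (-1 : R) 1 y].
Proof.
move=> muE.
have pdfE x : uniform_pdf (-1 : R) 1 x = if `|x| <= 1 then 2^-1 else 0 :> R.
  by rewrite /uniform_pdf -ler_norml; case: ifP => // _; congr (_^-1); lra.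
have bf : bell_density mu (uniform_pdf (-1 : R) 1).
  split; [exact: measurable_uniform_pdf|move=> {muE}x|exact: muE|move=> {muE}x y xy].
  - by apply: uniform_pdf_ge0; rewrite gtrN.
  - rewrite !pdfE; have [y1|y1] := leP `|y| 1.
      by rewrite (le_trans xy y1).
    by case: ifP => // _; rewrite invr_ge0.
move=> {muE}; split; first exact: bf.
  apply: (moments_of_density (C := expR 1) (b := 1) bf ltr01) => {bf}x.
  rewrite pdfE -expRD; case: ifPn => [x1|_]; last exact: expR_ge0.
  have x21 : x ^+ 2 <= 1 by rewrite -(real_normK (num_real x)) expr_le1.
  have := expR_ge1Dx (1 + - (1 * x ^+ 2)); lra.
move=> s x y z s0 x0 xy yz.
have y0 := le_trans x0 (ltW xy); have z0 := le_trans y0 (ltW yz).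
rewrite !pdfE !ger0_norm//.
have [z1|z1] := leP z 1; last first.
  by move=> _ gz; have := normal_pdf_ge0 0 s z; rewrite leNgt gz.
have y1 : y <= 1 by rewrite (le_trans _ z1)// ltW.
rewrite y1 (le_trans (ltW xy) y1) => gx _; apply: le_lt_trans gx.
by have [_ _ _ gle] := bell_gauss s0; apply: gle; rewrite !ger0_norm// ltW.
Qed.

(** The comparison property through which the law enters the main inequality. *)
Definition gauss_dominated mu (s : R) := [/\ 0 < s, exists f, bell_density mu f,
  moments mu, \int[mu]_x (x ^+ 2) = s ^+ 2 &
  forall k, rising_curvature k -> \int[mu]_x k x <= \int[gauss 1]_x k (s * x)].

(** Otherwise the law would be carried by the Lebesgue-null set [[set 0]]. *)
Lemma bell_second_moment_gt0 mu f : bell_density mu f -> moments mu ->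
  0 < \int[mu]_x (x ^+ 2).
Proof.
move=> [mf f0 muE _] mmu; rewrite lt_neqAle Rintegral_ge0 ?andbT; last first.
  by move=> x _; exact: sqr_ge0.
apply/negP => /eqP /esym m2.
have i2 := temperate_integrable mmu temperate_sqr.
have m20 : (\int[mu]_x `|(x ^+ 2)%:E| = 0)%E.
  rewrite -[RHS]/(0%:E) -m2 fineK; last by apply: integrable_fin_num i2.
  by apply: eq_integral => x _; rewrite gee0_abs// lee_fin sqr_ge0.
have msq : measurable_fun [set: R] (fun x : R => (x ^+ 2)%:E).
  by case/integrableP : i2.
have := (ae_eq_integral_abs mu measurableT msq).1 m20.
move=> [N [mN N0 sub]].
have subN : ~` [set 0] `<=` N.
  by move=> x x0; apply: sub => /= /(_ I) [] /eqP; rewrite sqrf_eq0 => /eqP.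
have : (mu [set: R] <= mu [set 0%R] + mu N)%E.
  have m0 : measurable [set (0 : R)] by exact: measurable_set1.
  rewrite -(setUv [set (0 : R)]); apply: (le_trans (measureU2 _ m0 (measurableC m0))).
  by apply: leeD2l; apply: le_measure; rewrite ?inE//; exact: measurableC.
have -> : mu setT = 1%E by exact: probability_setT.
by rewrite N0 adde0 muE// integral_set1 leNgt lte01.
Qed.

Lemma gauss_dominated_of_crossing mu f : bell_density mu f -> moments mu ->
  (forall s x y z, 0 < s -> 0 <= x -> x < y -> y < z ->
      normal_pdf 0 s x < f x -> normal_pdf 0 s z < f z -> normal_pdf 0 s y < f y) ->
  exists s, gauss_dominated mu s.
Proof.
move=> bf mmu cr; have m2 := bell_second_moment_gt0 bf mmu.
set m := \int[mu]_x _ in m2; pose s := Num.sqrt m.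
have s0 : 0 < s by rewrite sqrtr_gt0.
exists s; split=> //; first by exists f.
  by rewrite sqr_sqrtr// ltW.
move=> k rk; have [tk _ _] := rk.
rewrite -integral_gauss_scale//.
apply: (crossing_le bf (bell_gauss s0) mmu (moments_gauss s0)) => //; last first.
  by move=> x y z; exact: cr.
by rewrite gauss_variance// sqr_sqrtr// ltW.
Qed.

Lemma exp_power_gauss_dominated d (T : measurableType d) (P : probability T R)
    (q : \bar R) (X : {RV P >-> R}) : (2%:E <= q)%E -> has_exp_power_law P q X ->
  exists s, gauss_dominated (distribution P X) s.
Proof.
case: q => [q| |//].
- rewrite lee_fin => q2 [c c0 XE].
  have [bf mmu cr] := exp_power_bell q2 c0 XE.
  exact: gauss_dominated_of_crossing bf mmu cr.
- move=> _ XE.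
  have [bf mmu cr] := @uniform_bell (distribution P X) XE.
  exact: gauss_dominated_of_crossing bf mmu cr.
Qed.

(** The total mass 1 determines the constant in front of the density. *)
Lemma law_eq_of_density d (T : measurableType d) (P : probability T R)
    (q : \bar R) (X Y : {RV P >-> R}) : (2%:E <= q)%E -> has_exp_power_law P q X ->
  has_exp_power_law P q Y -> forall A, measurable A ->
  distribution P X A = distribution P Y A.
Proof.
case: q => [q| |//].
- rewrite lee_fin => q2 [c c0 XE] [e e0 YE] A mA.
  have mE : measurable_fun [set: R] (fun x : R => (expR (- (`|x| `^ q)))%:E).
    apply/measurable_EFinP; apply: continuous_measurable_fun => x.
    apply: (cvg_comp (fun x : R => - (`|x| `^ q)) expR); last exact: continuous_expR.
    by apply: cvgN; apply: continuous_norm_powR; rewrite (le_trans _ q2).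
  have IE k B : 0 < k -> measurable B -> (\int[leb]_(x in B) (k * expR (- (`|x| `^ q)))%:E =
      k%:E * \int[leb]_(x in B) (expR (- (`|x| `^ q)))%:E)%E.
    move=> k0 mB; under eq_integral do rewrite EFinM.
    have E0 (x : R) : (0 <= (expR (- (`|x| `^ q)))%:E)%E by rewrite lee_fin expR_ge0.
    have k0' : (0 <= k%:E)%E by rewrite lee_fin ltW.
    by apply: ge0_integralZl => //; exact: measurable_funTS mE.
  have ce : c = e.
    have H1 : distribution P X setT = 1%E by exact: probability_setT.
    have H2 : distribution P Y setT = 1%E by exact: probability_setT.
    move: H1 H2; rewrite XE// YE// IE// IE//.
    set I := integral _ _ _; have : (0 <= I)%E by apply: integral_ge0 => x _; rewrite lee_fin expR_ge0.
    case: I => [i| |]//= i0.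
      rewrite -!EFinM => h1 h2; have {}h1 := EFin_inj h1; have {}h2 := EFin_inj h2.
      have i00 : i != 0 by apply/eqP => i0'; move: h1; rewrite i0' mulr0; lra.
      by apply: (mulIf i00); rewrite h1 h2.
    by rewrite gt0_muley ?lte_fin.
  by rewrite XE// YE// ce.
- by move=> _ XE YE A mA; rewrite XE// YE.
Qed.

End ExpPowerLaw.

(** * Sums of independent variables *)
Section Independence.
Context {R : realType} (d : measure_display) (T : measurableType d) (P : probability T R).

(** If [E] is not null, [P] restricted to [E] and divided by [P E] sends
    [(X, Z)] to a measure which on rectangles is the product of the laws, hence
    is their product measure. The event [E] will carry the variables that are
    not yet in the sum. *)
Lemma product_law (X Z : {RV P >-> R}) (E : set T) : measurable E ->
  (forall A B : set R, measurable A -> measurable B ->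
    P ((X @^-1` A `&` Z @^-1` B) `&` E) = P (X @^-1` A) * P (Z @^-1` B) * P E)%E ->
  forall W : set (R * R), measurable W ->
    (P ([set w | W (X w, Z w)] `&` E) =
     (distribution P X \x distribution P Z)%E W * P E)%E.
Proof.
move=> mE ind W mW.
have mXZ : measurable_fun setT (fun w => (X w, Z w) : R * R) by exact: measurable_fun_pair.
have mWE : measurable [set w | W (X w, Z w)].
  by rewrite -[X in measurable X]setTI; exact: mXZ.
have PEfin : P E \is a fin_num by exact: fin_num_measure.
have [PE0|PE0] := eqVneq (P E) 0%E.
  rewrite PE0 mule0; apply/eqP; rewrite eq_le measure_ge0 andbT -PE0.
  by apply: le_measure; rewrite ?inE//; exact: measurableI.
have c0 : 0 < fine (P E) by rewrite fine_gt0// lt0e PE0 measure_ge0 ltey_eq PEfin.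
have ic0 : 0 <= (fine (P E))^-1 by rewrite invr_ge0 ltW.
pose F w : R * R := (X w, Z w).
pose m' := mscale (NngNum ic0) (pushforward (mrestr P mE) F).
rewrite (@product_measure_unique _ _ _ _ _ (distribution P X) (distribution P Z) (m' mXZ))//.
  transitivity (((fine (P E))^-1%:E * P ([set w | W (X w, Z w)] `&` E)) * P E)%E; last by [].
  by rewrite muleAC -{2}(fineK PEfin) -EFinM mulVf ?mul1e// gt_eqF.
move=> A B mA mB.
transitivity ((fine (P E))^-1%:E * P ((X @^-1` A `&` Z @^-1` B) `&` E))%E; first by [].
by rewrite ind// muleCA -{2}(fineK PEfin) -EFinM mulVf ?mule1// gt_eqF.
Qed.

(** The weights are indexed by all of [nat], which makes induction on the number
    of summands possible with fixed weights. *)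
Definition psum (a : nat -> R) (Y : nat -> {RV P >-> R}) (n : nat) (w : T) : R :=
  \sum_(i < n) a i * Y i w.

Lemma measurable_psum a Y n : measurable_fun setT (psum a Y n).
Proof.
by apply: measurable_sum => i; exact: measurable_funM.
Qed.

HB.instance Definition _ a Y n :=
  isMeasurableFun.Build _ _ _ _ (psum a Y n) (measurable_psum a Y n).

Lemma psumS a Y n w : psum a Y n.+1 w = psum a Y n w + a n * Y n w.
Proof. by rewrite /psum big_ord_recr. Qed.

Variable Y : nat -> {RV P >-> R}.
Hypothesis Yindep : mutually_independent P Y.

Let cyl (J : {fset nat}) (B : nat -> set R) := \bigcap_(i in [set` J]) (Y i @^-1` B i).

Let put (B : nat -> set R) (n : nat) (C : set R) (i : nat) := if i == n then C else B i.

Let measurable_cyl J B : (forall i, i \in J -> measurable (B i)) -> measurable (cyl J B).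
Proof.
move=> mB; apply: fin_bigcap_measurable; first exact: finite_fset.
by move=> i /= iJ; apply: measurable_funPTI => //; exact: mB.
Qed.

Let put_id n (J : {fset nat}) B C i : n \notin J -> i \in J -> put B n C i = B i.
Proof. by move=> nJ; rewrite /put; case: eqP => // ->; rewrite (negbTE nJ). Qed.

Let measurable_put n (J : {fset nat}) B C : n \notin J -> measurable C ->
  (forall i, i \in J -> measurable (B i)) ->
  forall i, i \in (n |` J)%fset -> measurable (put B n C i).
Proof.
move=> nJ mC mB i; rewrite !inE => /predU1P[->|iJ]; first by rewrite /put eqxx.
by rewrite (put_id _ _ nJ iJ); exact: mB.
Qed.

Let cyl_put n (J : {fset nat}) B C : n \notin J ->
  cyl (n |` J)%fset (put B n C) = Y n @^-1` C `&` cyl J B.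
Proof.
move=> nJ; apply/seteqP; split=> w /=.
  move=> H; split=> [|i /= iJ].
    by have := H n; rewrite /= !inE eqxx /put eqxx; apply.
  by have := H i; rewrite /= !inE iJ orbT (put_id _ _ nJ iJ); apply.
move=> [wn wJ] i /=; rewrite !inE => /predU1P[->|iJ]; first by rewrite /put eqxx.
by rewrite (put_id _ _ nJ iJ); exact: wJ.
Qed.

Let cyl1 n C : cyl [fset n]%fset (fun=> C) = Y n @^-1` C.
Proof.
apply/seteqP; split=> w /=; first by apply; rewrite /= inE.
by move=> wn i /=; rewrite inE => /eqP ->.
Qed.

Let indep_put n (J : {fset nat}) B C : n \notin J -> measurable C ->
  (forall i, i \in J -> measurable (B i)) ->
  (P (Y n @^-1` C `&` cyl J B) = P (Y n @^-1` C) * P (cyl J B))%E.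
Proof.
move=> nJ mC mB; rewrite -(cyl_put B C nJ).
have mB' := measurable_put nJ mC mB.
have := Yindep mB'; rewrite big_fsetU1//= {2}/put eqxx => ->.
rewrite -Yindep; last by move=> i iJ; apply: mB'; rewrite !inE iJ orbT.
by congr (_ * P _)%E; apply: eq_bigcapr => i /= iJ; rewrite (put_id _ _ nJ iJ).
Qed.

Let indep_later a n := forall A (J : {fset nat}) B, measurable A -> (forall i, i \in J -> (n <= i)%N) ->
  (forall i, i \in J -> measurable (B i)) ->
  (P (psum a Y n @^-1` A `&` cyl J B) = P (psum a Y n @^-1` A) * P (cyl J B))%E.

Let pair_law a n : indep_later a n -> forall W : set (R * R), measurable W ->
  (P [set w | W (psum a Y n w, Y n w)] =
   (distribution P (psum a Y n) \x distribution P (Y n))%E W)%E.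
Proof.
move=> ind W mW.
have indT (A C : set R) : measurable A -> measurable C ->
    (P ((psum a Y n @^-1` A `&` Y n @^-1` C) `&` setT) =
     P (psum a Y n @^-1` A) * P (Y n @^-1` C) * P setT)%E.
  move=> mA mC; rewrite setIT probability_setT mule1 -cyl1.
  by apply: ind => // i; rewrite inE => /eqP ->.
have := @product_law (psum a Y n) (Y n) _ measurableT indT W mW.
by rewrite setIT probability_setT mule1.
Qed.

(** The later variables are what makes the induction go through: one of them
    enters the sum at each step, the others go into the conditioning event. *)
Let psum_indep_later a n : indep_later a n.
Proof.
elim: n => [|n IH] A J B mA Jn mB.
  have [A0|A0] := pselect (A 0).
    rewrite (_ : psum a Y 0 @^-1` A = setT) ?setTI ?probability_setT ?mul1e//.
    by apply/seteqP; split=> // w _; rewrite /= /psum big_ord0.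
  rewrite (_ : psum a Y 0 @^-1` A = set0) ?set0I ?measure0 ?mul0e//.
  by apply/seteqP; split=> // w; rewrite /= /psum big_ord0.
have nJ : n \notin J by apply/negP => /Jn; rewrite ltnn.
have mE := measurable_cyl mB.
have indn (A' C : set R) : measurable A' -> measurable C ->
    (P ((psum a Y n @^-1` A' `&` Y n @^-1` C) `&` cyl J B) =
     P (psum a Y n @^-1` A') * P (Y n @^-1` C) * P (cyl J B))%E.
  move=> mA' mC; rewrite -muleA -(indep_put nJ mC mB) -setIA -(cyl_put B C nJ).
  apply: IH => //; last exact: measurable_put.
  by move=> i; rewrite !inE => /predU1P[->//|iJ]; rewrite ltnW// Jn.
pose W := [set z : R * R | A (z.1 + a n * z.2)].
have mW : measurable W.
  have mf : measurable_fun setT (fun z : R * R => z.1 + a n * z.2).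
    by apply: measurable_funD => //; exact: measurable_funM.
  by rewrite -[X in measurable X]setTI; exact: mf.
have WE : psum a Y n.+1 @^-1` A = [set w | W (psum a Y n w, Y n w)].
  by apply/seteqP; split=> w /=; rewrite /W /= psumS.
by rewrite WE (product_law mE indn mW) -(pair_law IH mW).
Qed.

Lemma psum_product_law a n (W : set (R * R)) : measurable W ->
  (P [set w | W (psum a Y n w, Y n w)] =
   (distribution P (psum a Y n) \x distribution P (Y n))%E W)%E.
Proof. exact (pair_law (@psum_indep_later a n) (W:=W)). Qed.

End Independence.

Lemma integral_probability_cst {R : realType} d (T : measurableType d)
  (Q : probability T R) (k : \bar R) : (\int[Q]_x k = k)%E.
Proof.
rewrite integral_cst//; transitivity (k * Q setT)%E; first by [].
by rewrite probability_setT mule1.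
Qed.

(** * Replacing the summands by Gaussian ones *)
Section Replacement.
Context {R : realType} (d : measure_display) (T : measurableType d) (P : probability T R).
Variables (Y : nat -> {RV P >-> R}) (mu : probability R R) (s : R).
Hypothesis Yindep : mutually_independent P Y.
Hypothesis Ymu : forall i (A : set R), measurable A -> distribution P (Y i) A = mu A.
Implicit Types (phi : R -> R) (a : nat -> R).

Let S a n : {RV P >-> R} := psum a Y n.
Local Notation law a n := (distribution P (S a n)).

Lemma ge0_psum_law a n (h : R * R -> \bar R) : measurable_fun setT h ->
  (forall z, 0 <= h z)%E ->
  (\int[P]_w h (S a n w, Y n w) = \int[law a n]_x \int[mu]_y h (x, y))%E.
Proof.
move=> mh h0.
have mF : measurable_fun setT (fun w => (S a n w, Y n w) : R * R).
  exact: measurable_fun_pair.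
pose F w : R * R := (S a n w, Y n w).
have E1 := @ge0_integral_pushforward _ _ _ _ _ F mF P setT h measurableT mh (fun z _ => h0 z).
transitivity (\int[pushforward P F]_z h z)%E; first by rewrite E1.
transitivity (\int[(law a n \x distribution P (Y n))%E]_z h z)%E.
  apply: eq_measure_integral => W mW _.
  exact: (psum_product_law Yindep a n mW).
rewrite fubini_tonelli1//; apply: eq_integral => x _.
by apply: eq_measure_integral => A mA _; exact: Ymu.
Qed.

Lemma ge0_integral_psum a n (h : R -> \bar R) : measurable_fun setT h ->
  (forall x, 0 <= h x)%E ->
  (\int[law a n]_x h x = \int[P]_w h (S a n w))%E.
Proof. by move=> mh h0; rewrite ge0_integral_distribution. Qed.

Hypothesis mmu : moments mu.

Lemma moments_psum a n : moments (law a n).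
Proof.
elim: n => [|n IH] m; apply/integrableP; split.
- by apply/measurable_EFinP; exact: measurable_weight.
- rewrite ge0_integral_psum//; last first.
    by apply: measurableT_comp => //; apply/measurable_EFinP; exact: measurable_weight.
  under eq_integral do rewrite /S /= /psum big_ord0.
  by rewrite integral_probability_cst ltry.
- by apply/measurable_EFinP; exact: measurable_weight.
rewrite ge0_integral_psum//; last first.
  by apply: measurableT_comp => //; apply/measurable_EFinP; exact: measurable_weight.
pose D := 2 ^+ m * weight m (a n).
have D0 : 0 <= D by rewrite mulr_ge0 ?weight_ge0 ?exprn_ge0.
pose h (z : R * R) : \bar R := (D * weight m z.1 * weight m z.2)%:E.
have mw : measurable_fun setT (weight m : R -> R) by exact: measurable_weight.
have mh : measurable_fun setT h.
  apply/measurable_EFinP; apply: measurable_funM.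
    by apply: measurable_funM => //; apply: (measurableT_comp mw).
  by apply: (measurableT_comp mw).
have h0 z : (0 <= h z)%E.
  by rewrite lee_fin mulr_ge0 ?weight_ge0// mulr_ge0 ?weight_ge0.
apply: (@le_lt_trans _ _ (\int[P]_w h (S a n w, Y n w))%E).
  apply: ge0_le_integral => //.
  - apply: measurableT_comp => //; apply/measurable_EFinP.
    by apply: (measurableT_comp mw); exact: measurable_psum.
  - by apply: (measurableT_comp mh); exact: measurable_fun_pair.
  move=> w _; rewrite /h /= lee_fin psumS ger0_norm ?weight_ge0//.
  rewrite (le_trans (weightD _ _ _))// /D -!mulrA ler_wpM2l ?exprn_ge0//.
  by rewrite mulrCA ler_wpM2l ?weight_ge0// weightM.
rewrite ge0_psum_law//.
pose M := \int[mu]_y weight m y.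
have hE x : (\int[mu]_y h (x, y) = (D * M * weight m x)%:E)%E.
  have iw : mu.-integrable setT (EFin \o (fun y => D * weight m x * weight m y)).
    by have := integrableZl measurableT (D * weight m x) (mmu m).
  have -> : D * M * weight m x = \int[mu]_y (D * weight m x * weight m y).
    by rewrite RintegralZl// -/M; ring.
  by rewrite fineK//; apply: integrable_fin_num iw.
under eq_integral do rewrite hE.
have /integrableP[_] := integrableZl measurableT (D * M) (IH m).
apply: le_lt_trans; apply: ge0_le_integral => //.
- move=> x _; rewrite lee_fin mulr_ge0 ?weight_ge0// mulr_ge0//.
  by apply: Rintegral_ge0 => y _; exact: weight_ge0.
- by apply/measurable_EFinP; exact: measurable_funM.
- by apply: measurableT_comp => //; apply/measurable_EFinP; exact: measurable_funM.
- by move=> x _; rewrite /= lee_fin ler_norm.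
Qed.

Lemma psum_integral0 a phi : temperate phi -> \int[law a 0]_x phi x = phi 0.
Proof.
move=> tphi; rewrite /Rintegral integral_distribution.
- under eq_integral do rewrite /S /= /psum big_ord0.
  by rewrite integral_probability_cst.
- by apply/measurable_EFinP; exact: temperate_measurable.
- rewrite (_ : _ \o _ = cst (phi 0)%:E); last first.
    by apply/funext => w; rewrite /= /psum big_ord0.
  exact: finite_measure_integrable_cst.
Qed.

Lemma psum_integralS a n phi : temperate phi ->
  \int[law a n.+1]_x phi x = \int[law a n]_x avg mu (a n) phi x.
Proof.
move=> tphi.
wlog phi0 : phi tphi / forall x, 0 <= phi x.
  have tabs := temperate_norm tphi.
  have tp : temperate (fun y => phi y + `|phi y|) by exact: temperateD.
  move=> H; have phiE : phi = (fun y => (phi y + `|phi y|) - `|phi y|).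
    by apply/funext => y; rewrite addrK.
  have avE : avg mu (a n) phi = (fun x => avg mu (a n) (fun y => phi y + `|phi y|) x -
      avg mu (a n) (fun y => `|phi y|) x).
    by apply/funext => x; rewrite {1}phiE avgB.
  rewrite avE [in LHS]phiE !RintegralB//; try by apply: temperate_integrable;
    [exact: moments_psum|by [|exact: temperate_avg]].
  rewrite !H// => y; have := ler_norm (- phi y); rewrite normrN; lra.
rewrite /Rintegral; congr fine.
have mphi := temperate_measurable tphi.
have mE : measurable_fun setT (EFin \o phi) by exact/measurable_EFinP.
rewrite (ge0_integral_psum _ _ mE); last by move=> x; rewrite lee_fin.
pose h (z : R * R) : \bar R := (phi (z.1 + a n * z.2))%:E.
have mh : measurable_fun setT h.
  apply/measurable_EFinP; apply: (measurableT_comp mphi).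
  by apply: measurable_funD => //; exact: measurable_funM.
have h0 z : (0 <= h z)%E by rewrite lee_fin.
transitivity (\int[P]_w h (S a n w, Y n w))%E.
  by apply: eq_integral => w _; rewrite /h /= psumS.
rewrite ge0_psum_law//; apply: eq_integral => x _.
by rewrite /h /= /avg fineK//; apply: integrable_fin_num => //; exact: avg_integrable.
Qed.

Definition l2norm a n := Num.sqrt (\sum_(i < n) a i ^+ 2).

Lemma l2norm_ge0 a n : 0 <= l2norm a n. Proof. exact: sqrtr_ge0. Qed.

Lemma sqr_l2norm a n : l2norm a n ^+ 2 = \sum_(i < n) a i ^+ 2.
Proof. by rewrite sqr_sqrtr// sumr_ge0// => i _; exact: sqr_ge0. Qed.

Hypothesis s0 : 0 < s.

(** Lindeberg's replacement: since averaging operators commute and the Gaussian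
    ones form a semigroup, a one-variable comparison valid on a class that is
    stable under averaging can be applied once for each summand. *)
Lemma replacement (K : (R -> R) -> Prop) (delta : R -> R) :
  (forall phi, K phi -> temperate phi) ->
  (forall phi b, K phi -> K (avg mu b phi)) ->
  (forall phi b, K phi -> K (avg (gauss 1) b phi)) ->
  (forall phi b, K phi -> avg mu b phi 0 <= avg (gauss 1) (s * b) phi 0 + delta b) ->
  forall a n phi, K phi -> \int[law a n]_x phi x <=
    avg (gauss 1) (s * l2norm a n) phi 0 + \sum_(i < n) delta (a i).
Proof.
move=> Kt Kmu Kg step a n; have mg := moments_gauss (@ltr01 R).
elim: n => [|n IH] phi Kphi.
  by rewrite (psum_integral0 _ (Kt _ Kphi)) /l2norm !big_ord0 sqrtr0 mulr0 avgE0 addr0.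
rewrite (psum_integralS _ _ (Kt _ Kphi)) (le_trans (IH _ (Kmu _ _ Kphi)))//.
(* The first [n] summands are Gaussian by induction; the last one is compared
   with the average over them as test function. *)
rewrite (avg_comm _ _ _ mg mmu (Kt _ Kphi)) big_ord_recr/= addrA [leRHS]addrAC lerD2r.
rewrite (le_trans (step _ _ (Kg _ _ Kphi)))// lerD2r le_eqVlt; apply/orP; left; apply/eqP.
apply: gauss_semigroup; first exact: Kt.
  by rewrite mulr_ge0 ?l2norm_ge0// ltW.
by rewrite !exprMn !sqr_l2norm big_ord_recr/=; ring.
Qed.

Lemma Lnorm_psum (p : R) a n : 1 <= p ->
  Lnorm P p%:E (EFin \o psum a Y n) = ((\int[law a n]_x (`|x| `^ p)) `^ p^-1)%:E.
Proof.
move=> p1; have tp := temperate_norm_powR p1.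
have ip := temperate_integrable (moments_psum a n) tp.
have mp : measurable_fun setT (fun x : R => (`|x| `^ p)%:E) by case/integrableP : ip.
rewrite unlock /= -poweR_EFin fineK; last by apply: integrable_fin_num ip.
rewrite (ge0_integral_psum _ _ mp); last by move=> x; rewrite lee_fin powR_ge0.
by congr (_ `^ _)%E; apply: eq_integral => w _; rewrite /= poweR_EFin.
Qed.

End Replacement.

(** * Smooth test functions and a smooth step *)
Section ThirdOrder.
Context {R : realType}.
Implicit Types (phi : R -> R) (mu : probability R R) (Lam : R).

(** A bound on the third derivative, stated so that averaging preserves it
    without any differentiability: [sdiff phi y x / y ^+ 2] approximates the
    second derivative at [x], and two such quotients with steps [y] and [z]
    differ by at most [Lam * (`|y| + `|z|)]. *)
Definition third_order Lam phi := temperate phi /\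
  forall x y z, `|z ^+ 2 * sdiff phi y x - y ^+ 2 * sdiff phi z x| <=
    Lam * (y ^+ 2 * z ^+ 2 * (`|y| + `|z|)).

Lemma third_order_avg Lam mu b phi : moments mu ->
  third_order Lam phi -> third_order Lam (avg mu b phi).
Proof.
move=> mmu [tphi phiL]; split; first exact: temperate_avg.
move=> x y z; rewrite !sdiff_avg//.
have ty := temperateZ (z ^+ 2) (temperate_sdiff y tphi).
have tz := temperateZ (y ^+ 2) (temperate_sdiff z tphi).
rewrite -!avgZ//; [|exact: temperate_sdiff..].
rewrite -avgB//; set psi := fun t => _.
have tpsi : temperate psi by exact: temperateB.
have ip := avg_integrable b x mmu tpsi.
rewrite /avg (le_trans (le_normr_Rintegral _ ip))//.
set K := Lam * _; rewrite -[leRHS](Rintegral_prob_cst mu).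
apply: le_Rintegral => //.
- exact: integrable_norm ip.
- exact: temperate_integrable (temperate_cst K).
- by move=> t _; exact: phiL.
Qed.

Lemma third_orderN Lam phi : third_order Lam phi -> third_order Lam (fun x => - phi x).
Proof.
move=> [tphi phiL]; split; first exact: temperateN.
move=> x y z; have := phiL x y z; rewrite -normrN; congr (`|_| <= _).
by rewrite /sdiff; ring.
Qed.

Lemma third_orderZ Lam (k : R) phi : third_order Lam phi ->
  third_order (`|k| * Lam) (fun x => k * phi x).
Proof.
move=> [tphi phiL]; split; first exact: temperateZ.
move=> x y z; rewrite -[leRHS]mulrA; apply: le_trans (ler_wpM2l (normr_ge0 k) (phiL x y z)).
by rewrite -normrM le_eqVlt; apply/orP; left; apply/eqP; congr `|_|; rewrite /sdiff; ring.
Qed.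

Lemma third_orderD L1 L2 phi psi : third_order L1 phi -> third_order L2 psi ->
  third_order (L1 + L2) (fun x => phi x + psi x).
Proof.
move=> [tphi phiL] [tpsi psiL]; split; first exact: temperateD.
move=> x y z; rewrite mulrDl; apply: le_trans (lerD (phiL x y z) (psiL x y z)).
apply: le_trans (ler_normD _ _).
by rewrite le_eqVlt; apply/orP; left; apply/eqP; congr `|_|; rewrite /sdiff; ring.
Qed.

Lemma third_order_affine Lam (k b : R) phi : third_order Lam phi ->
  third_order (Lam * `|k| ^+ 3) (fun x => phi (b + k * x)).
Proof.
move=> [tphi phiL]; split; first exact: temperate_affine.
move=> x y z.
have E u : sdiff (fun x => phi (b + k * x)) u x = sdiff phi (k * u) (b + k * x).
  by rewrite /sdiff !mulrDr mulrN !addrA.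
rewrite !E; have [->|k0] := eqVneq k 0.
  rewrite normr0 expr0n mulr0 !mul0r /sdiff addr0 subr0.
  by rewrite [X in `|X|](_ : _ = 0) ?normr0//; ring.
have k2 : 0 < k ^+ 2 by rewrite exprn_even_gt0.
rewrite -(ler_pM2l k2); have := phiL (b + k * x) (k * y) (k * z).
rewrite !normrM => H; rewrite -{1}(gtr0_norm k2) -normrM.
rewrite (_ : k ^+ 2 * (z ^+ 2 * sdiff phi (k * y) (b + k * x) - y ^+ 2 * sdiff phi (k * z) (b + k * x)) =
  (k * z) ^+ 2 * sdiff phi (k * y) (b + k * x) - (k * y) ^+ 2 * sdiff phi (k * z) (b + k * x)); last by ring.
apply: (le_trans H); rewrite le_eqVlt; apply/orP; left; apply/eqP.
by rewrite -(real_normK (num_real k)) !exprMn -(real_normK (num_real k)); ring.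
Qed.

(** Second-order expansion at 0 under an even law. The quotient with step [b]
    stands for the second derivative; as it does not depend on the law, the
    second-order terms cancel between two laws of the same variance. *)
Lemma third_order_taylor mu f Lam phi b : bell_density mu f -> moments mu ->
  third_order Lam phi -> b != 0 ->
  `|avg mu b phi 0 - phi 0 - sdiff phi b 0 / 2 * \int[mu]_y (y ^+ 2)| <=
  Lam / 2 * `|b| ^+ 3 * \int[mu]_y (`|y| ^+ 3 + y ^+ 2).
Proof.
move=> bf mmu [tphi phiL] b0.
have b2 : 0 < b ^+ 2 by rewrite exprn_even_gt0.
have t3 : temperate (fun y : R => `|y| ^+ 3 + y ^+ 2).
  apply: temperateD; last exact: temperate_sqr.
  have := @temperate_norm_powR R 3; rewrite ler1n => /(_ isT).
  by under eq_fun do rewrite powR_mulrn//.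
have tsd : temperate (fun y => sdiff phi (b * y) 0).
  rewrite /sdiff; apply: temperateB; last exact: temperate_cst.
  apply: temperateD; first exact: temperate_affine.
  by under eq_fun do rewrite -mulNr; exact: temperate_affine.
have i2 := temperate_integrable mmu temperate_sqr.
have isd := temperate_integrable mmu tsd.
have E : avg mu b phi 0 - phi 0 = 2^-1 * \int[mu]_y sdiff phi (b * y) 0.
  have aN := bell_avgN b 0 bf mmu tphi.
  have -> : avg mu b phi 0 = 2^-1 * (avg mu b phi 0 + avg mu (- b) phi 0) by rewrite aN; field.
  rewrite /avg -RintegralD//; [|exact: avg_integrable..].
  rewrite /sdiff RintegralB//; [|apply: temperate_integrable => //|exact: temperate_integrable (temperate_cst _)].
    rewrite Rintegral_prob_cst mulrBr mulrA mulVf ?mul1r//; congr (_ * _ - _).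
    by apply: eq_Rintegral => y _; rewrite mulNr.
  apply: temperateD; first exact: temperate_affine.
  by under eq_fun do rewrite -mulNr; exact: temperate_affine.
rewrite E; set k := sdiff phi b 0.
have -> : 2^-1 * \int[mu]_y sdiff phi (b * y) 0 - k / 2 * \int[mu]_y (y ^+ 2) =
   2^-1 * \int[mu]_y (sdiff phi (b * y) 0 - k * y ^+ 2).
  rewrite RintegralB//; last exact: temperate_integrable (temperateZ _ temperate_sqr).
  by rewrite RintegralZl//; field.
have tB : temperate (fun y => sdiff phi (b * y) 0 - k * y ^+ 2).
  by apply: temperateB => //; apply: temperateZ; exact: temperate_sqr.
have iB := temperate_integrable mmu tB.
set I := \int[mu]_y (`|y| ^+ 3 + _); rewrite normrM (@ger0_norm _ 2^-1) ?invr_ge0//.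
rewrite (_ : Lam / 2 * `|b| ^+ 3 * I = 2^-1 * (Lam * `|b| ^+ 3 * I)); last by ring.
rewrite ler_wpM2l ?invr_ge0//.
rewrite (le_trans (le_normr_Rintegral _ iB))// -RintegralZl//; last exact: temperate_integrable t3.
apply: le_Rintegral => //.
- exact: integrable_norm iB.
- exact: temperate_integrable (temperateZ _ t3).
move=> y _; have := phiL 0 (b * y) b; rewrite -/k.
rewrite (_ : b ^+ 2 * sdiff phi (b * y) 0 - (b * y) ^+ 2 * k =
  b ^+ 2 * (sdiff phi (b * y) 0 - k * y ^+ 2)); last by ring.
rewrite normrM (gtr0_norm b2) => H; rewrite -(ler_pM2l b2) (le_trans H)//.
rewrite le_eqVlt; apply/orP; left; apply/eqP.
rewrite normrM exprMn -[b ^+ 2](real_normK (num_real b)) -[y ^+ 2](real_normK (num_real y)).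
by ring.
Qed.

Definition pos3 (x : R) := Num.max x 0 ^+ 3.

(** The second derivative of [pos3] is [6 * Num.max x 0], which is Lipschitz. *)
Lemma third_order_pos3 : third_order 1 pos3.
Proof.
have mx (x : R) : (0 <= x /\ Num.max x 0 = x) \/ (x <= 0 /\ Num.max x 0 = 0).
  by have [x0|x0] := leP 0 x; [left|right; split => //; exact: ltW].
split.
  exists 3, 1%N; split=> // x y.
  rewrite /pos3 subrXX !big_ord_recr big_ord0 /= /weight !expr1.
  rewrite normrM (_ : 3 * `|x - y| * ((1 + x ^+ 2) * (1 + y ^+ 2)) = `|x - y| * (3 * ((1 + x ^+ 2) * (1 + y ^+ 2)))); last by ring.
  rewrite ler_pM//.
    case: (mx x) => -[x0 ->]; case: (mx y) => -[y0 ->] //; rewrite ?subr0 ?sub0r ?normrN.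
    - by rewrite (ger0_norm x0) ger0_norm; lra.
    - by rewrite (ger0_norm y0) ler0_norm; lra.
    - by rewrite normr0.
  rewrite ger0_norm.
    by case: (mx x) => -[x0 ->]; case: (mx y) => -[y0 ->]; nra.
  by case: (mx x) => -[x0 ->]; case: (mx y) => -[y0 ->]; nra.
have key x y : `|sdiff pos3 y x - 6 * Num.max x 0 * y ^+ 2| <= `|y| ^+ 3.
  wlog y0 : y / 0 <= y.
    move=> H; have [|/ltW y0] := leP 0 y; first exact: H.
    have := H (- y); rewrite oppr_ge0 => /(_ y0); rewrite normrN sqrrN.
    by congr (`|_ - _| <= _); rewrite /sdiff opprK; ring.
  rewrite (ger0_norm y0) /sdiff /pos3.
  have y3 : 0 <= y ^+ 3 by rewrite exprn_ge0.
  case: (mx (x + y)) => -[xy ->]; case: (mx (x - y)) => -[xy' ->]; case: (mx x) => -[x0 ->].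
  all: rewrite ?expr0n/= ?mulr0 ?mul0r ?subr0 ?addr0 ?add0r.
  - by rewrite [X in `|X|](_ : _ = 0) ?normr0//; ring.
  - have [-> ->] : x = 0 /\ y = 0 by split; lra.
    by rewrite [X in `|X|](_ : _ = 0) ?normr0//; ring.
  - rewrite [X in `|X|](_ : _ = (y - x) ^+ 3); last by ring.
    have yx : 0 <= y - x by lra.
    by rewrite ger0_norm ?exprn_ge0// lerXn2r ?nnegrE//; lra.
  - by rewrite ger0_norm ?exprn_ge0// lerXn2r ?nnegrE//; lra.
  - have [-> ->] : x = 0 /\ y = 0 by split; lra.
    by rewrite [X in `|X|](_ : _ = 0) ?normr0//; ring.
  - have [-> ->] : x = y /\ y = 0 by split; lra.
    by rewrite [X in `|X|](_ : _ = 0) ?normr0//; ring.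
  - have [-> ->] : x = 0 /\ y = 0 by split; lra.
    by rewrite [X in `|X|](_ : _ = 0) ?normr0//; ring.
  - by rewrite normr0.
move=> x y z.
have -> : z ^+ 2 * sdiff pos3 y x - y ^+ 2 * sdiff pos3 z x =
  z ^+ 2 * (sdiff pos3 y x - 6 * Num.max x 0 * y ^+ 2) -
  y ^+ 2 * (sdiff pos3 z x - 6 * Num.max x 0 * z ^+ 2) by ring.
rewrite (le_trans (ler_normB _ _))// mul1r (normrM (z ^+ 2)) (normrM (y ^+ 2)) (ger0_norm (sqr_ge0 z)) (ger0_norm (sqr_ge0 y)).
have := ler_wpM2l (sqr_ge0 z) (key x y); have := ler_wpM2l (sqr_ge0 y) (key x z).
move=> H1 H2; apply: (le_trans (lerD H2 H1)).
rewrite -[y ^+ 2](real_normK (num_real y)) -[z ^+ 2](real_normK (num_real z)).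
by rewrite le_eqVlt; apply/orP; left; apply/eqP; ring.
Qed.

(** As a function of [`|x|], the integral of the quadratic B-spline with nodes 1,
    2, 3, 4: the third difference of a truncated cubic. *)
Definition step (x : R) : R :=
  (pos3 (`|x| - 1) - 3 * pos3 (`|x| - 2) + 3 * pos3 (`|x| - 3) - pos3 (`|x| - 4)) / 6.

Lemma third_order_step : exists Lam, third_order Lam step.
Proof.
(* For [0 <= t] the truncated cubics in [x - t] and [- x - t] have disjoint
   supports, and their sum is the one in [`|x| - t]. *)
have abs3 (t : R) : 0 <= t -> exists Lam, third_order Lam (fun x => pos3 (`|x| - t)).
  move=> t0; exists (1 * `|1| ^+ 3 + 1 * `|-1| ^+ 3).
  have := third_orderD (third_order_affine 1 (- t) third_order_pos3)
    (third_order_affine (-1) (- t) third_order_pos3).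
  congr (third_order _ _); apply/funext => x; rewrite mul1r mulN1r /pos3.
  have [x0|x0] := leP 0 x.
    by rewrite ger0_norm// [Num.max (- t - x) 0]max_r ?expr0n ?addr0 ?[- t + x]addrC//; lra.
  by rewrite ltr0_norm// [Num.max (- t + x) 0]max_r ?expr0n ?add0r ?[- t - x]addrC//; lra.
have [L1 H1] := abs3 1 ler01; have [L2 H2] := abs3 2 (ler0n _ _).
have [L3 H3] := abs3 3 (ler0n _ _); have [L4 H4] := abs3 4 (ler0n _ _).
have := third_orderZ 6^-1 (third_orderD (third_orderD (third_orderD H1 (third_orderZ (-3) H2))
  (third_orderZ 3 H3)) (third_orderZ (-1) H4)).
set L := _ * _ => H; exists L; move: H; congr (third_order _ _); apply/funext => x.
by rewrite /step; ring.
Qed.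

Lemma step_spec (x : R) : [/\ 0 <= step x <= 1, `|x| <= 1 -> step x = 0 &
  4 <= `|x| -> step x = 1].
Proof.
rewrite /step /pos3; move: (`|x|) => u.
have mx (v : R) : (0 <= v /\ Num.max v 0 = v) \/ (v <= 0 /\ Num.max v 0 = 0).
  by have [v0|v0] := leP 0 v; [left|right; split => //; exact: ltW].
case: (mx (u - 1)) => -[u1 ->]; case: (mx (u - 2)) => -[u2 ->];
  case: (mx (u - 3)) => -[u3 ->]; case: (mx (u - 4)) => -[u4 ->]; try (exfalso; lra).
- rewrite (_ : _ / 6 = 1); last by field.
  by split=> //; [rewrite ler01 lexx|lra].
- split; [|lra|move=> h; have -> : u = 4 by lra]; last by field.
  rewrite ?expr0n /= subr0 ler_pdivlMr// ler_pdivrMr// mul0r mul1r.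
  have w0 : 0 <= 4 - u by lra.
  have w1 : 4 - u <= 1 by lra.
  have := exprn_ge0 3 w0; have := exprn_ile1 3 w0 w1.
  by move=> *; apply/andP; split; lra.
- split; [|lra|lra].
  rewrite ?expr0n /= mulr0 addr0 subr0 ler_pdivlMr// ler_pdivrMr// mul0r mul1r.
  have v0 : 0 <= u - 2 by [].
  have w0 : 0 <= 3 - u by lra.
  have := mulr_ge0 v0 (sqr_ge0 (3 - u)); have := mulr_ge0 (sqr_ge0 (u - 2)) w0.
  by have := sqr_ge0 (u - 2) => *; apply/andP; split; lra.
- split; [|move=> h; have -> : u = 1 by lra|lra]; last by rewrite ?expr0n/=; field.
  rewrite ?expr0n /= !mulr0 addr0 !subr0 ler_pdivlMr// ler_pdivrMr// mul0r mul1r.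
  have v0 : 0 <= u - 1 by [].
  have v1 : u - 1 <= 1 by lra.
  have := exprn_ge0 3 v0; have := exprn_ile1 3 v0 v1.
  by move=> *; apply/andP; split; lra.
- rewrite (_ : _ / 6 = 0); last by rewrite ?expr0n/=; field.
  by split=> //; [rewrite lexx ler01|lra].
Qed.

End ThirdOrder.

(** * The moment inequalities and a central limit theorem *)
Section SumComparison.
Context {R : realType} (d : measure_display) (T : measurableType d) (P : probability T R).
Variables (Y : nat -> {RV P >-> R}) (mu : probability R R) (s : R).
Hypothesis Yindep : mutually_independent P Y.
Hypothesis Ymu : forall i (A : set R), measurable A -> distribution P (Y i) A = mu A.
Hypothesis gd : gauss_dominated mu s.
Implicit Types (phi : R -> R) (a : nat -> R).
Local Notation law a n := (distribution P (psum a Y n)).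

Let s0 : 0 < s. Proof. by case: gd. Qed.
Let mmu : moments mu. Proof. by case: gd. Qed.
Let mg : moments (gauss (1 : R)). Proof. exact: moments_gauss. Qed.

Lemma psum_le_gauss a n phi : rising_curvature phi ->
  \int[law a n]_x phi x <= avg (gauss 1) (s * l2norm a n) phi 0.
Proof.
move=> rphi; have [_ [f bf] _ _ dom] := gd.
have := replacement (K := rising_curvature) (delta := fun=> 0) Yindep Ymu mmu s0.
rewrite /= => /(_ _ _ _ _ a n phi rphi); rewrite big1// addr0; apply.
- by move=> psi [].
- by move=> psi b; exact: rising_curvature_avg bf mmu.
- by move=> psi b; exact: rising_curvature_avg (bell_gauss ltr01) mg.
move=> psi b rpsi; rewrite addr0.
have := dom _ (rising_curvature_dilate b rpsi); rewrite /avg.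
under [X in _ <= X -> _]eq_Rintegral do rewrite mulrA [b * s]mulrC -[_ * _]add0r.
by under [X in X <= _ -> _]eq_Rintegral do rewrite -[_ * _]add0r.
Qed.

Lemma psum_ge_gauss a n phi : temperate phi -> rising_curvature (fun x => - phi x) ->
  avg (gauss 1) (s * l2norm a n) phi 0 <= \int[law a n]_x phi x.
Proof.
move=> tphi rphi; have ip := temperate_integrable (moments_psum Yindep Ymu mmu a n) tphi.
have := psum_le_gauss a n rphi; under eq_fun do rewrite -mulN1r.
rewrite avgZ//; under eq_Rintegral do rewrite -mulN1r.
by rewrite RintegralZl// !mulN1r lerN2.
Qed.

(** Both [x ^+ 2] and its opposite have rising curvature, so the comparison with
    the Gaussian law holds in both directions. *)
Lemma integral_psum_sqr a n : \int[law a n]_x (x ^+ 2) = (s * l2norm a n) ^+ 2.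
Proof.
have E k : avg (gauss 1) (s * l2norm a n) (fun x => k * x ^+ 2) 0 = k * (s * l2norm a n) ^+ 2.
  rewrite /avg; under eq_Rintegral do rewrite add0r exprMn mulrA.
  rewrite RintegralZl//; last exact: temperate_integrable mg temperate_sqr.
  by rewrite gauss_second_moment mulr1.
have i2 := temperate_integrable (moments_psum Yindep Ymu mmu a n) temperate_sqr.
have H1 := psum_le_gauss a n (rising_curvature_sqr 1).
have H2 := psum_le_gauss a n (rising_curvature_sqr (-1)).
rewrite !E !RintegralZl// in H1 H2; apply/eqP; rewrite eq_le; lra.
Qed.

Lemma avg_gauss_powR (v p : R) : 1 <= p -> 0 <= v ->
  avg (gauss 1) v (fun x => `|x| `^ p) 0 = (gauss_const p * v) `^ p.
Proof.
move=> p1 v0; rewrite powRM ?gauss_const_ge0// -gauss_abs_moment// mulrC /avg.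
rewrite -RintegralZl//; last exact: temperate_integrable mg (temperate_norm_powR p1).
by apply: eq_Rintegral => x _; rewrite add0r normrM powRM// (ger0_norm v0).
Qed.

Lemma Lnorm2_psum a n : Lnorm P 2%:E (EFin \o psum a Y n) = (s * l2norm a n)%:E.
Proof.
rewrite (Lnorm_psum Yindep Ymu mmu) ?ler1n//.
under eq_Rintegral do rewrite powR_mulrn// real_normK ?num_real//.
have v0 : 0 <= s * l2norm a n by rewrite mulr_ge0 ?l2norm_ge0// ltW.
by rewrite integral_psum_sqr -powR_mulrn// -powRrM mulfV// powRr1.
Qed.

Lemma ler_powR2r (p u v : R) : 1 <= p -> 0 <= u -> 0 <= v ->
  (u `^ p <= v `^ p) = (u <= v).
Proof.
move=> p1 u0 v0; have p0 : 0 < p by apply: lt_le_trans p1.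
have mono : {in Num.nneg &, {mono (@powR R)^~ p : x y / x <= y}}.
  by apply: le_mono_in => y z y0 z0 yz; exact: gt0_ltr_powR.
by apply: mono; rewrite nnegrE.
Qed.

Lemma powRV_galois (p x v : R) : 1 <= p -> 0 <= x -> 0 <= v ->
  (x `^ p^-1 <= v) = (x <= v `^ p) /\ (v <= x `^ p^-1) = (v `^ p <= x).
Proof.
move=> p1 x0 v0; have p0 : p != 0 by rewrite gt_eqF// (lt_le_trans _ p1).
have H : (x `^ p^-1) `^ p = x by rewrite -powRrM mulVf// powRr1.
have y0 := powR_ge0 x p^-1.
by split; [rewrite -(ler_powR2r p1 y0 v0) H|rewrite -(ler_powR2r p1 v0 y0) H].
Qed.

Lemma psum_Lnorm_le p a n : 2 <= p -> (Lnorm P p%:E (EFin \o psum a Y n) <=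
  (gauss_const p)%:E * Lnorm P 2%:E (EFin \o psum a Y n))%E.
Proof.
move=> p2; have p1 : 1 <= p by apply: le_trans p2; rewrite ler1n.
rewrite Lnorm2_psum (Lnorm_psum Yindep Ymu mmu)// -EFinM lee_fin.
have v0 : 0 <= s * l2norm a n by rewrite mulr_ge0 ?l2norm_ge0// ltW.
have gv0 : 0 <= gauss_const p * (s * l2norm a n) by apply: mulr_ge0 => //; exact: gauss_const_ge0.
have I0 : 0 <= \int[law a n]_x (`|x| `^ p) by apply: Rintegral_ge0 => x _; exact: powR_ge0.
rewrite (powRV_galois p1 I0 gv0).1.
by rewrite -avg_gauss_powR//; exact: psum_le_gauss (rising_curvature_powR p2).
Qed.

Lemma psum_Lnorm_ge p a n : 1 <= p <= 2 ->
  ((gauss_const p)%:E * Lnorm P 2%:E (EFin \o psum a Y n) <=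
    Lnorm P p%:E (EFin \o psum a Y n))%E.
Proof.
move=> /andP[p1 p2].
rewrite Lnorm2_psum (Lnorm_psum Yindep Ymu mmu)// -EFinM lee_fin.
have p0 : 0 < p by apply: lt_le_trans p1.
have v0 : 0 <= s * l2norm a n by rewrite mulr_ge0 ?l2norm_ge0// ltW.
have gv0 : 0 <= gauss_const p * (s * l2norm a n) by apply: mulr_ge0 => //; exact: gauss_const_ge0.
have I0 : 0 <= \int[law a n]_x (`|x| `^ p) by apply: Rintegral_ge0 => x _; exact: powR_ge0.
rewrite (powRV_galois p1 I0 gv0).2.
rewrite -avg_gauss_powR//; apply: psum_ge_gauss; first exact: temperate_norm_powR.
by apply: rising_curvature_powRN; rewrite ?p1.
Qed.

(** Expand to second order under both laws at each replacement; only the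
    remainders, of order [`|a i| ^+ 3], are left. *)
Lemma third_order_clt_bound Lam : exists2 C : R, 0 <= C &
  forall a n phi, third_order Lam phi ->
  `|\int[law a n]_x phi x - avg (gauss 1) (s * l2norm a n) phi 0| <=
    \sum_(i < n) C * `|a i| ^+ 3.
Proof.
have [_ [f bf] _ m2 _] := gd.
pose M (nu : probability R R) := \int[nu]_y (`|y| ^+ 3 + y ^+ 2).
have M0 nu : 0 <= M nu.
  by apply: Rintegral_ge0 => x _; rewrite addr_ge0 ?sqr_ge0// exprn_ge0.
pose C := `|Lam| / 2 * (M mu + M (gauss s)).
have C0 : 0 <= C by rewrite mulr_ge0 ?divr_ge0 ?addr_ge0.
exists C => //.
have step phi b : third_order Lam phi ->
    avg mu b phi 0 <= avg (gauss 1) (s * b) phi 0 + C * `|b| ^+ 3.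
  move=> lphi; have [tphi _] := lphi.
  have -> : avg (gauss 1) (s * b) phi 0 = avg (gauss s) b phi 0.
    rewrite [in RHS]/avg (@integral_gauss_scale _ s (fun y => phi (0 + b * y)))//; last exact: temperate_affine.
    by apply: eq_Rintegral => x _; rewrite mulrA [b * s]mulrC.
  have [->|b0] := eqVneq b 0.
    by rewrite !avgE0 lerDl mulr_ge0.
  have := third_order_taylor (bell_gauss s0) (moments_gauss s0) lphi b0.
  have := third_order_taylor bf mmu lphi b0.
  rewrite m2 (gauss_variance s0) -/(M mu) -/(M (gauss s)) !ler_norml => /andP[_ H1] /andP[H2 _].
  have b3 : 0 <= `|b| ^+ 3 by rewrite exprn_ge0.
  have LC : Lam / 2 * `|b| ^+ 3 * M mu + Lam / 2 * `|b| ^+ 3 * M (gauss s) <= C * `|b| ^+ 3.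
    rewrite -mulrDr /C [leRHS]mulrAC ler_wpM2r ?addr_ge0// ler_wpM2r// ler_wpM2r ?invr_ge0//.
    exact: ler_norm.
  lra.
have H a n phi : third_order Lam phi -> \int[law a n]_x phi x <=
    avg (gauss 1) (s * l2norm a n) phi 0 + \sum_(i < n) C * `|a i| ^+ 3.
  move=> lphi.
  have := replacement (K := third_order Lam) (delta := fun b => C * `|b| ^+ 3) Yindep Ymu mmu s0.
  apply => //.
  - by move=> psi [].
  - by move=> psi b; exact: third_order_avg.
  - by move=> psi b; exact: third_order_avg.
move=> a n phi lphi; have [tphi _] := lphi.
have ip := temperate_integrable (moments_psum Yindep Ymu mmu a n) tphi.
have := H a n _ (third_orderN lphi); under eq_fun do rewrite -mulN1r.
rewrite avgZ//; under eq_Rintegral do rewrite -mulN1r.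
rewrite RintegralZl// !mulN1r => H1; have H2 := H a n _ lphi.
by rewrite ler_norml; apply/andP; split; lra.
Qed.

(** The equal weights that make [psum] the normalized sum of the central limit
    theorem. *)
Definition clt_weight (n : nat) : nat -> R := fun=> (Num.sqrt n.+1%:R)^-1.

Lemma l2norm_clt_weight n : l2norm (clt_weight n) n.+1 = 1.
Proof.
rewrite /l2norm /clt_weight sumr_const card_ord exprVn sqr_sqrtr//.
by rewrite -[_ *+ n.+1]mulr_natr mulVf ?sqrtr1// pnatr_eq0.
Qed.

(** With [n.+1] equal weights the error is [C] divided by the square root of
    [n.+1]. *)
Lemma third_order_clt Lam phi : third_order Lam phi ->
  (fun n => \int[law (clt_weight n) n.+1]_x phi x) @ \oo --> avg (gauss 1) s phi 0.
Proof.
move=> lphi; have [C C0 H] := third_order_clt_bound Lam.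
apply/cvgrPdist_le => e e0.
have : (fun n : nat => C * (Num.sqrt n.+1%:R)^-1 : R) @ \oo --> C * 0.
  apply: cvgM; first exact: cvg_cst.
  apply/gtr0_cvgV0.
    by apply: nearW => n; rewrite sqrtr_gt0.
  apply/cvgryPge => A.
  near=> n.
  have nA : A ^+ 2 <= n.+1%:R.
    apply: (@le_trans _ _ n%:R); last by rewrite ler_nat.
    near: n; exact: nbhs_infty_ger.
  by rewrite (le_trans (ler_norm A))// -sqrtr_sqr ler_wsqrtr.
rewrite mulr0 => /cvgrPdist_le /(_ e e0); apply: filterS => n; rewrite sub0r normrN => hn.
have := H (clt_weight n) n.+1 phi lphi.
rewrite l2norm_clt_weight mulr1 distrC => h; apply: (le_trans h).
apply: le_trans hn; rewrite ger0_norm; last by rewrite mulr_ge0// invr_ge0.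
have v0 : 0 < Num.sqrt n.+1%:R :> R by rewrite sqrtr_gt0.
rewrite /clt_weight sumr_const card_ord -mulrnAr ler_wpM2l//.
have vi0 : 0 <= (Num.sqrt n.+1%:R)^-1 :> R by rewrite invr_ge0 ltW.
rewrite -mulr_natr (ger0_norm vi0) -{2}[n.+1%:R]sqr_sqrtr//.
by rewrite le_eqVlt; apply/orP; left; apply/eqP; field; rewrite gt_eqF.
Unshelve. all: by end_near.
Qed.

End SumComparison.

(** * Moments as integrals of smoothed tails *)
Section Tails.
Context {R : realType}.
Implicit Types (nu : probability R R) (p t : R).
Local Notation leb := (@lebesgue_measure R).

Lemma step_temperate : temperate (@step R).
Proof. by have [Lam []] := @third_order_step R. Qed.

Lemma step_ge0 (x : R) : 0 <= step x. Proof. by have [/andP[]] := step_spec x. Qed.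

Lemma step_le1 (x : R) : step x <= 1. Proof. by have [/andP[]] := step_spec x. Qed.

Lemma step0 : step (0 : R) = 0.
Proof. by have [_ -> //] := step_spec (0 : R); rewrite normr0. Qed.

Lemma step_norm (x : R) : step `|x| = step x.
Proof. by rewrite /step normr_id. Qed.

(** Written with real powers the inverse is a composition of measurable
    functions; at 0 both sides are 0. *)
Lemma measurable_inv : measurable_fun [set: R] (fun t : R => t^-1).
Proof.
have -> : (fun t : R => t^-1) = (fun t => t * (`|t| `^ (-1)) ^+ 2).
  apply/funext => t; have [->|t0] := eqVneq t 0; first by rewrite invr0 mul0r.
  by rewrite powR_inv1// exprVn real_normK ?num_real//; field.
apply: measurable_funM => //; apply: measurable_funX.
by apply: (measurableT_comp (measurable_powR _)); exact: normr_measurable.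
Qed.

Lemma measurable_norm_powR p : measurable_fun [set: R] (fun x : R => `|x| `^ p).
Proof. by apply: (measurableT_comp (measurable_powR _)); exact: normr_measurable. Qed.

(** A smoothed version of the probability of [t < `|x|], for [0 < t]. *)
Definition smooth_tail nu t : R := \int[nu]_x step (x / t).

Definition tail_const p : R := \int[leb]_u (step u^-1 * `|u| `^ (p - 1)).

Lemma measurable_step : measurable_fun [set: R] (@step R).
Proof. exact: temperate_measurable step_temperate. Qed.

Lemma integrable_step nu t : nu.-integrable setT (EFin \o (fun x => step (x / t))).
Proof.
apply: (@le_integrable _ _ _ _ _ measurableT _ (cst 1%E)).
- apply/measurable_EFinP; apply: (measurableT_comp measurable_step).
  exact: measurable_funM.
- by move=> x _; rewrite /= lee_fin normr1 ger0_norm ?step_ge0 ?step_le1.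
- exact: finite_measure_integrable_cst.
Qed.

Lemma smooth_tail_ge0 nu t : 0 <= smooth_tail nu t.
Proof. by apply: Rintegral_ge0 => x _; exact: step_ge0. Qed.

Lemma smooth_tail_le1 nu t : smooth_tail nu t <= 1.
Proof.
rewrite -(Rintegral_prob_cst nu 1); apply: le_Rintegral => //.
- exact: integrable_step.
- exact: finite_measure_integrable_cst.
- by move=> x _; exact: step_le1.
Qed.

Let le_indic p (u : R) : 1 <= p ->
  step u^-1 * `|u| `^ (p - 1) <= \1_(`[-1, 1]%classic : set R) u.
Proof.
move=> p1; rewrite indicE; have [u1|u1] := leP `|u| 1.
  rewrite mem_set ?mulr1n; last by rewrite /= in_itv /= -ler_norml.
  rewrite -[leRHS]mulr1 ler_pM ?step_ge0 ?powR_ge0 ?step_le1//.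
  apply: (@le_trans _ _ (1 `^ (p - 1))); last by rewrite powR1.
  by apply: ge0_ler_powR; rewrite ?nnegrE ?subr_ge0.
have [_ s0 _] := step_spec u^-1; rewrite s0 ?mul0r//.
by rewrite normfV invf_le1 ?ltW// (lt_trans ltr01).
Qed.

Let tail_integrand_ge0 p (u : R) : 0 <= step u^-1 * `|u| `^ (p - 1).
Proof. by rewrite mulr_ge0 ?step_ge0 ?powR_ge0. Qed.

Let measurable_tail_integrand p :
  measurable_fun [set: R] (fun u : R => step u^-1 * `|u| `^ (p - 1)).
Proof.
apply: measurable_funM; last exact: measurable_norm_powR.
exact: (measurableT_comp measurable_step measurable_inv).
Qed.

Let integrable_tail_integrand p : 1 <= p ->
  leb.-integrable setT (EFin \o (fun u => step u^-1 * `|u| `^ (p - 1))).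
Proof.
move=> p1; apply: (le_integrable measurableT _ _ (@integrable_indic_itv R (-1) 1 true false)).
  by apply/measurable_EFinP; exact: measurable_tail_integrand.
move=> u _; rewrite /= lee_fin (ger0_norm (tail_integrand_ge0 _ _)).
by rewrite (le_trans (le_indic u p1))// ler_norm.
Qed.

Lemma tail_const_gt0 p : 1 <= p -> 0 < tail_const p.
Proof.
move=> p1; pose c : R := 8^-1 `^ (p - 1).
have c0 : 0 < c by rewrite powR_gt0 ?invr_gt0.
suff : c * 8^-1 <= tail_const p by apply: lt_le_trans; rewrite mulr_gt0 ?invr_gt0.
have mI : measurable (`[8^-1, 4^-1]%classic : set R) by exact: measurable_itv.
(* For [u <= 1/4] the step at [u^-1] is 1, and [1/8 <= u] bounds the power. *)
have mE : leb (`[8^-1, 4^-1]%classic : set R) = (8^-1)%:E.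
  rewrite lebesgue_measure_itv/= lte_fin ltf_pV2 ?posrE// ltr_nat/=.
  by congr EFin; field.
have -> : c * 8^-1 = \int[leb]_u (c * \1_(`[8^-1, 4^-1]%classic : set R) u).
  rewrite RintegralZl//; last exact: (integrable_indic_itv 8^-1 4^-1 true false).
  by rewrite /Rintegral integral_indic// setIT; congr (_ * _); rewrite -[LHS]/(fine (8^-1)%:E) -mE.
apply: le_Rintegral => //.
- exact: (integrableZl measurableT c (integrable_indic_itv 8^-1 4^-1 true false)).
- exact: integrable_tail_integrand.
move=> u _; rewrite indicE; case: (boolP (u \in _)) => [|_]; last first.
  by rewrite mulr0; exact: tail_integrand_ge0.
rewrite inE /= in_itv /= => /andP[u1 u2].
have u0 : 0 < u by apply: lt_le_trans u1; rewrite invr_gt0.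
have [_ _ s1] := step_spec u^-1; rewrite s1.
  rewrite mulr1 mul1r ge0_ler_powR ?nnegrE ?subr_ge0 ?invr_ge0//.
  by rewrite gtr0_norm.
by rewrite normfV gtr0_norm// -[4]invrK lef_pV2 ?posrE ?invr_gt0.
Qed.

(** Substituting [t = |x| u] turns the inner integral into [|x| ^ p] times a
    constant. *)
Lemma layer_cake nu p : 1 <= p -> moments nu ->
  leb.-integrable setT (EFin \o (fun t => smooth_tail nu t * `|t| `^ (p - 1))) /\
  \int[leb]_t (smooth_tail nu t * `|t| `^ (p - 1)) =
    tail_const p * \int[nu]_x (`|x| `^ p).
Proof.
move=> p1 mnu; have tp := temperate_norm_powR p1.
have ip := temperate_integrable mnu tp.
pose h (z : R * R) : \bar R := (step (z.2 / z.1) * `|z.1| `^ (p - 1))%:E.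
have h0 z : (0 <= h z)%E by rewrite lee_fin mulr_ge0 ?step_ge0 ?powR_ge0.
have mh : measurable_fun [set: R * R] h.
  apply/measurable_EFinP; apply: measurable_funM.
    apply: (measurableT_comp measurable_step); apply: measurable_funM => //.
    exact: (measurableT_comp measurable_inv).
  exact: (measurableT_comp (measurable_norm_powR _)).
have tailE t : (smooth_tail nu t * `|t| `^ (p - 1))%:E = (\int[nu]_x h (t, x))%E.
  have it := integrable_step nu t.
  rewrite /smooth_tail /h /=.
  have -> : \int[nu]_x step (x / t) * `|t| `^ (p - 1) =
      \int[nu]_x (step (x / t) * `|t| `^ (p - 1)) by rewrite RintegralZr.
  rewrite fineK//; apply: integrable_fin_num => //.
  exact: (integrableZr measurableT (`|t| `^ (p - 1)) it).
have kE : (\int[leb]_u (step u^-1 * `|u| `^ (p - 1))%:E = (tail_const p)%:E)%E.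
  by rewrite fineK//; exact: integrable_fin_num (integrable_tail_integrand p1).
have inner x : (\int[leb]_t h (t, x) = (tail_const p * `|x| `^ p)%:E)%E.
  have [->|x0] := eqVneq x 0.
    rewrite normr0 powR0 ?mulr0; last by rewrite gt_eqF// (lt_le_trans ltr01).
    by apply: integral0_eq => t _; rewrite /h /= mul0r step0 mul0r.
  have ax : 0 < `|x| by rewrite normr_gt0.
  have mhx : measurable_fun [set: R] (fun t => h (t, x)) by exact: measurableT_comp.
  rewrite (@ge0_integral_affine _ `|x| 0 (fun t => h (t, x)))//; last by rewrite gt_eqF.
  have hE u : h (`|x| * u + 0, x) =
      ((`|x| `^ (p - 1))%:E * (step u^-1 * `|u| `^ (p - 1))%:E)%E.
    have sE : step (x / (`|x| * u)) = step u^-1.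
      rewrite -step_norm -[RHS]step_norm; congr step.
      by rewrite normrM !normfV normrM normr_id invfM mulrA mulfV ?gt_eqF// mul1r.
    rewrite /h /= addr0 sE normrM normr_id powRM// -EFinM; congr EFin.
    by ring.
  under eq_integral do rewrite hE.
  have k0 u : (0 <= (step u^-1 * `|u| `^ (p - 1))%:E)%E by rewrite lee_fin tail_integrand_ge0.
  have mk : measurable_fun [set: R] (fun u => (step u^-1 * `|u| `^ (p - 1))%:E).
    by apply/measurable_EFinP; exact: measurable_tail_integrand.
  have c0 : (0 <= (`|x| `^ (p - 1))%:E)%E by rewrite lee_fin powR_ge0.
  rewrite (ge0_integralZl leb measurableT mk (fun u _ => k0 u) c0).
  rewrite kE normr_id -!EFinM; congr EFin.
  rewrite mulrA [RHS]mulrC; congr (_ * _).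
  by rewrite -{1}(powRr1 (normr_ge0 x)) -powRD ?(gt_eqF ax) ?implybT// addrC subrK.
have F := @fubini_tonelli _ _ (measurableTypeR R) R R leb nu h mh h0.
have E : (\int[leb]_t (smooth_tail nu t * `|t| `^ (p - 1))%:E =
    (tail_const p * \int[nu]_x (`|x| `^ p))%:E)%E.
  under eq_integral do rewrite tailE.
  rewrite F; under eq_integral do rewrite inner.
  rewrite -RintegralZl// fineK//; apply: integrable_fin_num => //.
  exact: (integrableZl measurableT (tail_const p) ip).
split; last by rewrite /Rintegral E.
apply/integrableP; split.
  rewrite [X in measurable_fun _ X](_ : _ = fun t => (\int[nu]_x h (t, x))%E); last first.
    by apply/funext => t; rewrite /= tailE.
  exact: (@measurable_fun_fubini_tonelli_F _ _ (measurableTypeR R) R R nu h mh h0).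
under eq_integral do rewrite /= ger0_norm ?mulr_ge0 ?smooth_tail_ge0 ?powR_ge0//.
by rewrite E ltry.
Qed.

Lemma fatou_le (f : nat -> R -> R) (g : R -> R) (K : R) :
  (forall n, leb.-integrable setT (EFin \o f n)) -> leb.-integrable setT (EFin \o g) ->
  (forall n x, 0 <= f n x) -> (forall x, f ^~ x @ \oo --> g x) ->
  (forall n, \int[leb]_x f n x <= K) -> \int[leb]_x g x <= K.
Proof.
move=> fi gi f0 fg fK.
have mf n : measurable_fun [set: measurableTypeR R] (EFin \o f n).
  by have /integrableP[] := fi n.
have f0' n x : setT x -> (0 <= (EFin \o f n) x)%E by move=> _; rewrite lee_fin.
have := @fatou _ _ R leb setT measurableT (fun n => EFin \o f n) mf f0'.
have -> : (fun x => limn_einf ((fun n => EFin \o f n)^~ x)) = EFin \o g.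
  apply/funext => x; have H : (fun n => (f n x)%:E) @ \oo --> (g x)%:E.
    by apply: cvg_EFin; [exact: nearW|exact: fg].
  by have [] := cvg_limn_einf_sup H.
move=> H; rewrite -lee_fin fineK; last exact: integrable_fin_num gi.
apply: (le_trans H).
rewrite limn_einf_lim; apply: lime_le; first exact: is_cvg_einfs.
apply: nearW => n; apply: (@le_trans _ _ (\int[leb]_x (f n x)%:E)%E).
  by apply: ereal_inf_lbound; exists n => //=.
by rewrite -(fineK (integrable_fin_num measurableT (fi n))) lee_fin; exact: fK.
Qed.

End Tails.

(** * Optimality of the constant *)

(** Makes Fatou's lemma applicable to the difference of a second moment and a
    [p]-th moment: off [[-1, 1]] the former dominates, and on [[-1, 1]] the
    indicator makes up for the difference. *)
Lemma truncated_gap_ge0 {R : realType} (p t u : R) : 1 <= p <= 2 -> 0 <= u <= 1 ->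
  0 <= u * `|t| `^ (2 - 1) - u * `|t| `^ (p - 1) + \1_(`[-1, 1]%classic : set R) t.
Proof.
move=> /andP[p1 p2] /andP[u0 u1]; rewrite (_ : 2 - 1 = 1); last by ring.
rewrite powRr1// -mulrBr indicE; have [t1|t1] := leP `|t| 1.
  rewrite mem_set /=; last by rewrite /= in_itv /= -ler_norml.
  have w1 : `|t| `^ (p - 1) <= 1.
    apply: (@le_trans _ _ (1 `^ (p - 1))); last by rewrite powR1.
    by apply: ge0_ler_powR; rewrite ?nnegrE ?subr_ge0.
  by have := normr_ge0 t; have := powR_ge0 `|t| (p - 1); nra.
have tp : `|t| `^ (p - 1) <= `|t| by apply: ler1_powR (ltW t1) _; lra.
by rewrite addr_ge0// mulr_ge0// subr_ge0.
Qed.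

Section Optimality.
Context {R : realType} (d : measure_display) (T : measurableType d) (P : probability T R).
Variables (Y : nat -> {RV P >-> R}) (mu : probability R R) (s : R).
Hypothesis Yindep : mutually_independent P Y.
Hypothesis Ymu : forall i (A : set R), measurable A -> distribution P (Y i) A = mu A.
Hypothesis gd : gauss_dominated mu s.
Local Notation leb := (@lebesgue_measure R).
Local Notation law n := (distribution P (psum (clt_weight n) Y n.+1)).

Let s0 : 0 < s. Proof. by case: gd. Qed.
Let mlaw n : moments (law n).
Proof. by apply: moments_psum Yindep Ymu _ _ _; case: gd. Qed.
Let mgs : moments (gauss s). Proof. exact: moments_gauss. Qed.

Lemma cvg_smooth_tail t :
  (fun n => smooth_tail (law n) t) @ \oo --> smooth_tail (gauss s) t.
Proof.
have [Lam L] := @third_order_step R.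
have E (nu : probability R R) : smooth_tail nu t = \int[nu]_x step (0 + t^-1 * x).
  by apply: eq_Rintegral => x _; rewrite add0r mulrC.
have -> : smooth_tail (gauss s) t = avg (gauss 1) s (fun x => step (0 + t^-1 * x)) 0.
  rewrite E integral_gauss_scale//; last exact: temperate_affine (@step_temperate R).
  by apply: eq_Rintegral => x _; rewrite [0 + s * x]add0r.
have -> : (fun n => smooth_tail (law n) t) = (fun n => \int[law n]_x step (0 + t^-1 * x)).
  by apply/funext => n; exact: E.
refine (third_order_clt Yindep Ymu gd (third_order_affine t^-1 0 L)).
Qed.

Lemma gauss_scaled_moment p : 1 <= p ->
  \int[gauss s]_x (`|x| `^ p) = (gauss_const p * s) `^ p.
Proof.
move=> p1; rewrite integral_gauss_scale//; last exact: temperate_norm_powR.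
rewrite -(avg_gauss_powR p1 (ltW s0)).
by apply: eq_Rintegral => x _; rewrite add0r.
Qed.

(** Fatou's lemma for the smoothed tails, which converge by the central limit
    theorem. *)
Lemma gauss_moment_le p K : 1 <= p ->
  (forall n, \int[law n]_x (`|x| `^ p) <= K) -> (gauss_const p * s) `^ p <= K.
Proof.
move=> p1 HK; have k0 := tail_const_gt0 p1.
rewrite -gauss_scaled_moment// -(ler_pM2l k0).
have [ig <-] := layer_cake p1 mgs.
apply: (fatou_le (f := fun n t => smooth_tail (law n) t * `|t| `^ (p - 1)) _ ig).
- by move=> n; have [] := layer_cake p1 (mlaw n).
- by move=> n t; rewrite mulr_ge0 ?powR_ge0// smooth_tail_ge0.
- by move=> t; apply: cvgM; [exact: cvg_smooth_tail|exact: cvg_cst].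
- by move=> n; have [_ ->] := layer_cake p1 (mlaw n); rewrite ler_pM2l//; exact: HK.
Qed.

(** Fatou's lemma bounds limits from below; applied to the second moment minus
    the [p]-th one, of which the former is the same for all sums, it bounds the
    [p]-th moments from above in the limit. *)
Lemma le_gauss_moment p K : 1 <= p <= 2 ->
  (forall n, K <= \int[law n]_x (`|x| `^ p)) -> K <= (gauss_const p * s) `^ p.
Proof.
move=> p12 HK; have /andP[p1 p2] := p12; have k0 := tail_const_gt0 p1.
have p2' : 1 <= 2 :> R by rewrite ler1n.
have sq (nu : probability R R) : \int[nu]_x (`|x| `^ 2) = \int[nu]_x (x ^+ 2).
  by apply: eq_Rintegral => x _; rewrite powR_mulrn// real_normK ?num_real.
have sqlaw n : \int[law n]_x (`|x| `^ 2) = s ^+ 2.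
  by rewrite sq (integral_psum_sqr Yindep Ymu gd) l2norm_clt_weight mulr1.
have sqg : \int[gauss s]_x (`|x| `^ 2) = s ^+ 2.
  by rewrite sq gauss_variance.
pose I : R -> R := \1_(`[-1, 1]%classic : set R).
have iI : leb.-integrable setT (EFin \o I) := integrable_indic_itv (-1) 1 true false.
pose F (nu : probability R R) t := smooth_tail nu t * `|t| `^ (2 - 1) -
  smooth_tail nu t * `|t| `^ (p - 1) + I t.
have FE nu : moments nu -> leb.-integrable setT (EFin \o F nu) /\
    \int[leb]_t F nu t = tail_const 2 * \int[nu]_x (`|x| `^ 2) -
      tail_const p * \int[nu]_x (`|x| `^ p) + \int[leb]_t I t.
  move=> mnu; have [i2 <-] := layer_cake p2' mnu; have [i1 <-] := layer_cake p1 mnu.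
  have iB := integrableB measurableT i2 i1.
  split; first exact (integrableD measurableT iB iI).
  by rewrite /F RintegralD// RintegralB.
have [ig gE] := FE _ mgs.
have : \int[leb]_t F (gauss s) t <=
    tail_const 2 * s ^+ 2 - tail_const p * K + \int[leb]_t I t.
  apply: (fatou_le (f := fun n => F (law n)) _ ig).
  - by move=> n; have [] := FE _ (mlaw n).
  - by move=> n t; apply: truncated_gap_ge0 => //; rewrite smooth_tail_ge0 smooth_tail_le1.
  - move=> t; apply: cvgD; last exact: cvg_cst.
    by apply: cvgB; (apply: cvgM; [exact: cvg_smooth_tail|exact: cvg_cst]).
  - move=> n; have [_ ->] := FE _ (mlaw n); rewrite sqlaw lerD2r lerD2l lerN2.
    by rewrite ler_pM2l//; exact: HK.
by rewrite gE sqg lerD2r lerD2l lerN2 ler_pM2l// gauss_scaled_moment.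
Qed.

Lemma optimal_upper p C : 1 <= p ->
  (forall n, (Lnorm P p%:E (EFin \o psum (clt_weight n) Y n.+1) <=
    C%:E * Lnorm P 2%:E (EFin \o psum (clt_weight n) Y n.+1))%E) -> gauss_const p <= C.
Proof.
move=> p1; have mmu : moments mu by case: gd.
have p0 : 0 < p by apply: lt_le_trans p1.
have M0 n : 0 <= \int[law n]_x (`|x| `^ p) by apply: Rintegral_ge0 => x _; exact: powR_ge0.
move=> H; have {}H n : (\int[law n]_x (`|x| `^ p)) `^ p^-1 <= C * s.
  have := H n; rewrite (Lnorm2_psum Yindep Ymu gd) (Lnorm_psum Yindep Ymu mmu)//.
  by rewrite l2norm_clt_weight mulr1 -EFinM lee_fin.
have Cs0 : 0 <= C * s by apply: le_trans (H 0%N); exact: powR_ge0.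
have gs0 : 0 <= gauss_const p * s by apply: mulr_ge0; [exact: gauss_const_ge0|exact: ltW].
rewrite -(ler_pM2r s0) -(ler_powR2r p1 gs0 Cs0).
by apply: gauss_moment_le => // n; rewrite -(powRV_galois p1 (M0 n) Cs0).1; exact: H.
Qed.

Lemma optimal_lower p C : 1 <= p <= 2 ->
  (forall n, (C%:E * Lnorm P 2%:E (EFin \o psum (clt_weight n) Y n.+1) <=
    Lnorm P p%:E (EFin \o psum (clt_weight n) Y n.+1))%E) -> C <= gauss_const p.
Proof.
move=> p12 H; have /andP[p1 p2] := p12; have mmu : moments mu by case: gd.
have [C0|/ltW C0] := leP C 0; first exact: le_trans C0 (gauss_const_ge0 p).
have M0 n : 0 <= \int[law n]_x (`|x| `^ p) by apply: Rintegral_ge0 => x _; exact: powR_ge0.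
have {}H n : C * s <= (\int[law n]_x (`|x| `^ p)) `^ p^-1.
  have := H n; rewrite (Lnorm2_psum Yindep Ymu gd) (Lnorm_psum Yindep Ymu mmu)//.
  by rewrite l2norm_clt_weight mulr1 -EFinM lee_fin.
have Cs0 : 0 <= C * s by apply: mulr_ge0 => //; exact: ltW.
have gs0 : 0 <= gauss_const p * s by apply: mulr_ge0; [exact: gauss_const_ge0|exact: ltW].
rewrite -(ler_pM2r s0) -(ler_powR2r p1 Cs0 gs0).
by apply: le_gauss_moment => // n; rewrite -(powRV_galois p1 (M0 n) Cs0).2; exact: H.
Qed.

End Optimality.

Theorem theorem2 (R : realType) (q : \bar R) (hq : (2%:E <= q)%E)
  (d : measure_display) (T : measurableType d) (P : probability T R)
  (Y : nat -> {RV P >-> R})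
  (Yindep : mutually_independent P Y)
  (Ylaw : forall i : nat, has_exp_power_law P q (Y i)) :
  (forall p : R, 2 <= p ->
    (forall (n : nat) (a : 'I_n -> R), (1 <= n)%N ->
      (Lnorm P p%:E (EFin \o lincomb a Y)
        <= (gauss_const p)%:E * Lnorm P 2%:E (EFin \o lincomb a Y))%E) /\
    (forall C : R,
      (forall (n : nat) (a : 'I_n -> R), (1 <= n)%N ->
        (Lnorm P p%:E (EFin \o lincomb a Y)
          <= C%:E * Lnorm P 2%:E (EFin \o lincomb a Y))%E) ->
      gauss_const p <= C)) /\
  (forall p : R, 1 <= p <= 2 ->
    (forall (n : nat) (a : 'I_n -> R), (1 <= n)%N ->
      ((gauss_const p)%:E * Lnorm P 2%:E (EFin \o lincomb a Y)
        <= Lnorm P p%:E (EFin \o lincomb a Y))%E) /\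
    (forall C : R,
      (forall (n : nat) (a : 'I_n -> R), (1 <= n)%N ->
        (C%:E * Lnorm P 2%:E (EFin \o lincomb a Y)
          <= Lnorm P p%:E (EFin \o lincomb a Y))%E) ->
      C <= gauss_const p)).
Proof.
have [s gd] := exp_power_gauss_dominated hq (Ylaw 0%N).
have Ymu i (A : set R) : measurable A -> distribution P (Y i) A = distribution P (Y 0%N) A.
  exact: law_eq_of_density hq (Ylaw i) (Ylaw 0%N) A.
(* The coefficients, extended by 0 to all of [nat]. *)
have linE n (a : 'I_n -> R) :
    lincomb a Y = psum (fun i => oapp a 0 (insub i)) Y n :> (T -> R).
  by apply/funext => w; apply: eq_bigr => i _; rewrite valK.
split=> p hp; (split=> [n a _|C HC]).
- by rewrite linE; exact: psum_Lnorm_le Yindep Ymu gd _ _ _ hp.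
- have p1 : 1 <= p by apply: le_trans hp; rewrite ler1n.
  apply: (optimal_upper Yindep Ymu gd p1) => n.
  exact: (HC n.+1 (fun i => clt_weight n i) isT).
- by rewrite linE; exact: psum_Lnorm_ge Yindep Ymu gd _ _ _ hp.
apply: (optimal_lower Yindep Ymu gd hp) => n.
exact: (HC n.+1 (fun i => clt_weight n i) isT).
Qed.
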